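(* Let $K$ be a finite simplicial complex, $d\ge0$, such that every $d$-simplex of $K$ is contained in at least one $(d+1)$-simplex, and let $p\ge1$. The eigenvalues of the normalized up $p$-Laplacian $\Delta^{up}_{d,p}$ lie in $[0,(d+2)^{p-1}]$. In addition, for $p>1$, the spectrum of $\Delta_{d,p}^{up}$ contains $(d+2)^{p-1}$ if and only if the underlying anti-signed graph $G^-_{up}(S_d)$ has a balanced component. Moreover (for $p>1$), the multiplicity of $(d+2)^{p-1}$ equals the number of balanced components of $G^-_{up}(S_d)$.
   Context: $S_d$ is the set of $d$-simplices of $K$, each with a fixed orientation $[\tau]$. $B_{d+1}$ is the incidence matrix of the boundary map $\partial_{d+1}$ from $(d+1)$-chains to $d$-chains, with rows indexed by $S_d$ and columns by $S_{d+1}$; its entries are $\mathrm{sgn}([\tau],\partial[\sigma])\in\{-1,1\}$ if $\tau\subset\sigma$ (the coefficient of $[\tau]$ in $\partial[\sigma]$) and $0$ otherwise. $\deg_\tau=\#\{\sigma\in S_{d+1}:\tau\subset\sigma\}$. The eigenvalues (eigenvectors) of $\Delta^{up}_{d,p}$ are those of the function pair $F(x)=\|B_{d+1}^\top x\|_p^p$, $G(x)=\sum_{\tau\in S_d}\deg_\tau|x_\tau|^p$ on $\mathbb R^{S_d}$: $(\lambda,x)$, $x\ne0$, with $\nabla F(x)\cap\lambda\nabla G(x)\ne\varnothing$ ($\nabla$ the subdifferential). The multiplicity of an eigenvalue is the Krasnoselskii genus of the (symmetric) set of its eigenvectors, i.e. the least $s$ for which there is an odd continuous map from this set to $\mathbb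 S^{s-1}$. Underlying anti-signed graph $G^-_{up}(S_d)$: vertex set $S_d$; distinct $\tau,\tau'$ are adjacent if there is $\sigma\in S_{d+1}$ with $\tau,\tau'\subset\sigma$, and the edge has sign $\mathrm{sgn}([\tau],[\tau'])=\mathrm{sgn}([\tau],\partial[\sigma])\cdot\mathrm{sgn}([\tau'],\partial[\sigma])$. A balanced component is a connected component in which every cycle has positive product of signs (equivalently, its vertex set splits into two parts so that an edge is negative if and only if it joins different parts). *)

(* Defs.v *)
From HB Require Import structures.
From mathcomp Require Import all_boot all_order all_algebra all_fingroup.
From mathcomp Require Import all_classical all_reals all_analysis.

Set Implicit Arguments.
Unset Strict Implicit.
Unset Printing Implicit Defensive.

Import Order.TTheory GRing.Theory Num.Theory.
Import numFieldNormedType.Exports.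
Local Open Scope classical_set_scope.
Local Open Scope ring_scope.

Record simplicial_complex (V : finType) := SimplicialComplex {
  faces : {set {set V}};
  faces_neq0 : finset.set0 \notin faces;
  faces_down : forall s t : {set V},
    s \in faces -> t \subset s -> t != finset.set0 -> t \in faces
}.

Definition simplex (V : finType) (K : simplicial_complex V) (d : nat) : finType :=
  {s : {set V} | (s \in faces K) && (#|s| == d.+1)}.

(* An orientation of a simplex (an ordering of its vertices up to even
   permutations) is given by a representative ordering; everything below
   depends on it only through [orient_sign]. *)
Record orientation (V : finType) (K : simplicial_complex V) := Orientation {
  ordering :> {set V} -> seq V;
  orderingP : forall s, s \in faces K -> perm_eq (ordering s) (enum s)
}.

(* The integer e such that [s] = e [t] as oriented simplices: the sign of the
   permutation carrying s to t, and 0 if s and t do not span the same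
   simplex.  The support condition makes the permutation unique. *)
Definition orient_sign (V : finType) (s t : seq V) : int :=
  if [pick q : {perm V} | perm_on [set x in s]%SET q & map q s == t] is Some q
  then (-1) ^+ q else 0.

(* sgn([t], \partial [s]): the coefficient of [t] in
   \partial [v_0, ..., v_k] = \sum_i (-1)^i [v_0, ..., v_(i-1), v_(i+1), ..., v_k]. *)
Definition bd_sign (V : finType) (K : simplicial_complex V) (o : orientation K)
    (t s : {set V}) : int :=
  \sum_(v <- o s) (-1) ^+ index v (o s) * orient_sign (rem v (o s)) (o t).

(* B_(d+1) *)
Definition incidence_mx (R : realType) (V : finType) (K : simplicial_complex V)
    (o : orientation K) (d : nat) : 'M[R]_(#|simplex K d|, #|simplex K d.+1|) :=
  \matrix_(i, j) (bd_sign o (val (enum_val i)) (val (enum_val j)))%:~R.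

Definition up_degree (V : finType) (K : simplicial_complex V) (d : nat)
    (t : simplex K d) : nat :=
  #|[set s : simplex K d.+1 | val t \subset val s]%SET|.

Definition up_energy (R : realType) (V : finType) (K : simplicial_complex V)
    (o : orientation K) (d : nat) (p : R) (x : 'cV[R]_#|simplex K d|) : R :=
  \sum_j `|((incidence_mx R o d)^T *m x) j 0| `^ p.

Definition up_weight (R : realType) (V : finType) (K : simplicial_complex V)
    (d : nat) (p : R) (x : 'cV[R]_#|simplex K d|) : R :=
  \sum_i (up_degree (enum_val i))%:R * `|x i 0| `^ p.

Definition subdifferential (R : realType) (n : nat) (F : 'cV[R]_n -> R)
    (x : 'cV[R]_n) : set 'cV[R]_n :=
  [set g : 'cV[R]_n | forall y : 'cV[R]_n, F x + \sum_i g i 0 * (y i 0 - x i 0) <= F y].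

(* Eigenvectors of a function pair (F, G) for the value lam. *)
Definition eigenvectors (R : realType) (n : nat) (F G : 'cV[R]_n -> R) (lam : R) :
    set 'cV[R]_n :=
  [set x : 'cV[R]_n | x != 0 /\
    subdifferential F x `&` [set lam *: g | g in subdifferential G x] !=set0].

Definition spectrum (R : realType) (n : nat) (F G : 'cV[R]_n -> R) : set R :=
  [set lam : R | eigenvectors F G lam !=set0].

Definition unit_sphere (R : realType) (s : nat) : set 'cV[R]_s :=
  [set y : 'cV[R]_s | \sum_i y i 0 ^+ 2 = 1].

Definition odd_map_to_sphere (R : realType) (n : nat) (A : set 'cV[R]_n) (s : nat) :
    Prop :=
  exists f : 'cV[R]_n -> 'cV[R]_s,
    [/\ {within A, continuous f},
        forall x, A x -> unit_sphere (f x) &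
        forall x, A x -> f (- x) = - f x].

(* The Krasnoselskii genus of A is s; in particular it is 0 iff A is empty. *)
Definition is_genus (R : realType) (n : nat) (A : set 'cV[R]_n) (s : nat) : Prop :=
  odd_map_to_sphere A s /\ forall s', odd_map_to_sphere A s' -> (s <= s')%N.

Definition is_multiplicity (R : realType) (n : nat) (F G : 'cV[R]_n -> R)
    (lam : R) (m : nat) : Prop :=
  is_genus (eigenvectors F G lam) m.

Definition up_adj (V : finType) (K : simplicial_complex V) (d : nat) :
    rel (simplex K d) :=
  fun t t' => (t != t') &&
    [exists s : simplex K d.+1, (val t \subset val s) && (val t' \subset val s)].

(* Distinct d-simplices lie in at most one common (d+1)-simplex, so the choice
   made by [pick] is harmless (see [edge_signE]). *)
Definition edge_sign (V : finType) (K : simplicial_complex V) (o : orientation K)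
    (d : nat) (t t' : simplex K d) : int :=
  if [pick s : simplex K d.+1 | (val t \subset val s) && (val t' \subset val s)]
    is Some s
  then bd_sign o (val t) (val s) * bd_sign o (val t') (val s) else 0.

Lemma edge_signE (V : finType) (K : simplicial_complex V) (o : orientation K)
    (d : nat) (t t' : simplex K d) (s : simplex K d.+1) :
  t != t' -> val t \subset val s -> val t' \subset val s ->
  edge_sign o t t' = bd_sign o (val t) (val s) * bd_sign o (val t') (val s).
Proof.
move=> tt' ts t's; rewrite /edge_sign; case: pickP => [s1 /andP[ts1 t's1]|/(_ s)];
  last by rewrite ts t's.
suff -> : s1 = s by [].
have cardU : (d.+1 < #|val t :|: val t'|)%N.
  have /andP[_ /eqP ct] := valP t; have /andP[_ /eqP ct'] := valP t'.
  rewrite -{1}ct; apply: proper_card; rewrite finset.properEneq finset.subsetUl andbT.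
  apply: contra_neq tt' => /esym/finset.setUidPl t't.
  by apply/val_inj/esym/eqP; rewrite eqEcard t't ct ct' leqnn.
suff E (u : simplex K d.+1) : val t \subset val u -> val t' \subset val u ->
    val u = val t :|: val t'.
  by apply: val_inj; rewrite (E s1) // (E s).
move=> tu t'u; apply/esym/eqP; rewrite eqEcard finset.subUset tu t'u /=.
by have /andP[_ /eqP ->] := valP u.
Qed.

Definition up_components (V : finType) (K : simplicial_complex V) (d : nat) :
    {set {set simplex K d}} :=
  equivalence_partition (connect (@up_adj V K d)) [set: simplex K d]%SET.

Definition balanced (V : finType) (K : simplicial_complex V) (o : orientation K)
    (d : nat) (C : {set simplex K d}) : Prop :=
  forall c : seq (simplex K d),
    (2 < size c)%N -> ucycle (@up_adj V K d) c -> {subset c <= C} ->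
    0 < \prod_(t <- c) edge_sign o t (next c t).

Definition balanced_components (V : finType) (K : simplicial_complex V)
    (o : orientation K) (d : nat) : {set {set simplex K d}} :=
  [set C in up_components K d | `[< balanced o C >]]%SET.

(* Main.v *)
Require Import Defs.
From HB Require Import structures.
From mathcomp Require Import all_boot all_order all_algebra all_fingroup.
From mathcomp Require Import all_classical all_reals all_analysis.
From mathcomp Require Import zify ring lra.

Set Implicit Arguments.
Unset Strict Implicit.
Unset Printing Implicit Defensive.

Import Order.TTheory GRing.Theory Num.Theory.
Import numFieldNormedType.Exports.
Local Open Scope classical_set_scope.
Local Open Scope ring_scope.

(** Write [F] for the energy, [G] for the weight and [lmax] for [(d+2)^(p-1)].

    Bounds.  Both functions are [p]-homogeneous, so a subgradient at [x] pairs with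
    [x] to [p] times the value at [x] (Euler's identity, [euler_subgradient]); hence
    an eigenvector satisfies [F x = lam * G x].  The coboundary at a [(d+1)]-simplex
    is a signed sum over its [d+2] facets, and the power mean inequality bounds its
    [p]-th power by [lmax] times the sum of the [p]-th powers of the entries.  Summed
    over all [(d+1)]-simplices this is [F x <= lmax * G x].

    Extremal eigenvectors.  For [1 < p] equality in the power mean inequality forces
    all the signed entries on the facets of each [(d+1)]-simplex to agree; such a
    chain is called coherent below.  Conversely, at a coherent chain the explicit
    gradient of [F] is [lmax] times that of [G].  So the eigenvectors for [lmax] are
    the nonzero vectors of the linear space of coherent chains ([eigenvectors_maxE]).

    Signed graph.  Coherence says that crossing an edge of the graph on the
    [d]-simplices multiplies the entry by the sign of the edge.  A coherent chain is
    therefore determined on a component by its value at a root, a nonzero value makes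
    all cycles of the component positive, and on a balanced component the signs of
    walks from the root give a coherent chain ([switching_function]).  So the
    coherent chains are parametrized by one real number for each balanced component.

    Multiplicity.  It remains to see that a punctured space of dimension [k] has
    genus [k].  Normalizing the coordinates gives an odd map to the [(k-1)]-sphere;
    that no smaller sphere will do is the Borsuk-Ulam theorem ([borsuk_ulam]).  It is
    proved here by Fan's combinatorial argument with cochains modulo 2.  A map to the
    [(m-1)]-sphere labels points by a coordinate that is bounded away from 0 and its
    sign.  The cochain that counts alternating simplices, whose labels sorted by
    absolute value have alternating signs starting with a fixed one, has coboundary
    itself plus its antipode ([coboundary_fan], [fan_flip_sign]).  The octahedral
    sphere is the suspension of the one of lower dimension, so this identity makes
    the number of alternating simplices in its subdivision odd, by induction on
    dimension ([octahedron_fan]).  But the labels of an alternating simplex have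
    distinct absolute values ([fan_pigeonhole]), so [m] is at least the number [k] of
    vertices of a top-dimensional simplex. *)

(** * Cochains modulo 2, subdivision and the octahedral sphere *)

Section Cochains.
Variable T : eqType.
(* A simplex is the sequence of its vertices, possibly repeated; the empty simplex
   is allowed, which makes the complex augmented. *)
Implicit Types (g h : seq T -> bool) (s r : seq T) (v b : T).

Definition symmetric_cochain g := forall s r, perm_eq s r -> g s = g r.

Definition coboundary g s : bool := \big[addb/false]_(v <- s) g (rem v s).

Lemma symmetric_cons g b : symmetric_cochain g -> symmetric_cochain (fun r => g (b :: r)).
Proof. by move=> sg s r sr; apply: sg; rewrite perm_cons. Qed.

Lemma perm_eq_rem v s r : perm_eq s r -> perm_eq (rem v s) (rem v r).
Proof.
move=> sr; have [vs|vs] := boolP (v \in s); last first.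
  by rewrite !rem_id -?(perm_mem sr).
have vr : v \in r by rewrite -(perm_mem sr).
by rewrite -(perm_cons v) -(permPr (perm_to_rem vr)) -(permPl (perm_to_rem vs)).
Qed.

Lemma coboundary_symmetric g : symmetric_cochain g -> symmetric_cochain (coboundary g).
Proof.
move=> sg s r sr; rewrite /coboundary (perm_big _ sr) /=.
by apply: eq_bigr => v _; apply/sg/perm_eq_rem.
Qed.

Lemma eq_coboundary g h : g =1 h -> coboundary g =1 coboundary h.
Proof. by move=> gh s; apply: eq_bigr. Qed.

Lemma coboundary_add g h s :
  coboundary (fun r => g r (+) h r) s = coboundary g s (+) coboundary h s.
Proof. by rewrite /coboundary big_split. Qed.

(** The dual of the cone formula: deleting a vertex of the cone over [s] with
    apex [b] either removes the apex or leaves the cone over a facet of [s]. *)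
Lemma coboundary_cons g b s : symmetric_cochain g ->
  coboundary g (b :: s) = g s (+) coboundary (fun r => g (b :: r)) s.
Proof.
move=> sg; rewrite /coboundary big_cons /= eqxx; congr (_ (+) _).
rewrite !big_seq; apply: eq_bigr => v vs; apply: sg.
by have [->|//] := eqVneq b v; apply: perm_to_rem.
Qed.

Lemma coboundaryK g s : symmetric_cochain g -> coboundary (coboundary g) s = false.
Proof.
elim: s g => [|b s IH] g sg; first exact: big_nil.
rewrite coboundary_cons; last exact: coboundary_symmetric.
rewrite (eq_coboundary (fun r => coboundary_cons b r sg)) coboundary_add.
by rewrite IH ?addbF ?addbb //; exact: symmetric_cons.
Qed.

End Cochains.

Lemma coboundary_map (T U : eqType) (f : T -> U) (g : seq U -> bool) s :
  symmetric_cochain g -> coboundary (fun r => g (map f r)) s = coboundary g (map f s).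
Proof.
move=> sg; rewrite /coboundary big_map !big_seq; apply: eq_bigr => v vs; apply: sg.
rewrite -(perm_cons (f v)) -(permPr (perm_to_rem (map_f f vs))) -map_cons.
by apply: perm_map; rewrite perm_sym perm_to_rem.
Qed.

Section Subdivision.
Variable T : eqType.
Implicit Types (g h : seq T -> bool) (s r : seq T) (v b : T).
Variable bary : seq T -> T.
Hypothesis perm_bary : forall s r, perm_eq s r -> bary s = bary r.

(** The dual of barycentric subdivision: [subdivide g s] is the sum of the
    values of [g] on the simplices of the subdivision of [s].  That subdivision
    is the cone from the barycenter of [s] over the subdivided facets of [s];
    the counter [n] is the number of vertices of [s]. *)
Fixpoint subdivide_rec n g s : bool :=
  if n is m.+1 then
    \big[addb/false]_(v <- s) subdivide_rec m (fun r => g (bary s :: r)) (rem v s)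
  else g s.

Definition subdivide g s := subdivide_rec (size s) g s.

Lemma subdivide_nil g : subdivide g [::] = g [::].
Proof. by []. Qed.

Lemma subdivideE g s : (0 < size s)%N ->
  subdivide g s =
  \big[addb/false]_(v <- s) subdivide (fun r => g (bary s :: r)) (rem v s).
Proof.
case def_n: (size s) => [//|n] _; rewrite /subdivide def_n /= !big_seq.
by apply: eq_bigr => v vs; rewrite size_rem // def_n.
Qed.

Lemma simplex_ind (P : seq T -> Prop) :
  P [::] ->
  (forall s, (0 < size s)%N -> (forall v, v \in s -> P (rem v s)) -> P s) ->
  forall s, P s.
Proof.
move=> P0 PS s; have [n] := ubnP (size s); elim: n s => // n IH [//|x s] lesn.
by apply: PS => // v vs; apply: IH; rewrite size_rem.
Qed.

Lemma eq_subdivide g h : g =1 h -> subdivide g =1 subdivide h.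
Proof.
move=> gh s; elim/simplex_ind: s g h gh => [|s s0 IH] g h gh.
  by rewrite !subdivide_nil.
by rewrite !subdivideE // !big_seq; apply: eq_bigr => v vs; apply: IH.
Qed.

Lemma subdivide_add g h s :
  subdivide (fun r => g r (+) h r) s = subdivide g s (+) subdivide h s.
Proof.
elim/simplex_ind: s g h => [|s s0 IH] g h; first by rewrite !subdivide_nil.
rewrite !subdivideE // -big_split /= !big_seq.
by apply: eq_bigr => v vs; rewrite IH.
Qed.

Lemma subdivide_symmetric g : symmetric_cochain g -> symmetric_cochain (subdivide g).
Proof.
move=> sg s; elim/simplex_ind: s g sg => [|s s0 IH] g sg r sr.
  by move: (perm_size sr) => /=/esym/size0nil ->.
rewrite !subdivideE -?(perm_size sr) // (perm_bary sr) -(perm_big _ sr) /=.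
rewrite !big_seq; apply: eq_bigr => v vs.
by apply: IH => //; [exact: symmetric_cons|exact: perm_eq_rem].
Qed.

(** Subdivision is a chain map: the boundary of a cone over a cycle is that cycle,
    and the subdivided boundary of a simplex is a cycle by induction. *)
Lemma subdivide_coboundary g s : symmetric_cochain g ->
  subdivide (coboundary g) s = coboundary (subdivide g) s.
Proof.
elim/simplex_ind: s g => [|s s0 IH] g sg.
  by rewrite subdivide_nil /coboundary !big_nil.
set gb := fun r => g (bary s :: r).
have sgb : symmetric_cochain gb by exact: symmetric_cons.
rewrite subdivideE //.
transitivity (\big[addb/false]_(v <- s)
   (subdivide g (rem v s) (+) coboundary (subdivide gb) (rem v s))).
  rewrite !big_seq; apply: eq_bigr => v vs.
  rewrite (eq_subdivide (fun r => coboundary_cons (bary s) r sg)).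
  by rewrite subdivide_add IH.
rewrite big_split /= -/(coboundary _ s) -/(coboundary _ s).
by rewrite coboundaryK ?addbF //; exact: subdivide_symmetric.
Qed.

Variable a : T -> T.
Hypothesis aK : involutive a.
Hypothesis bary_map : forall s, bary (map a s) = a (bary s).

Lemma rem_map_inj v s : rem (a v) (map a s) = map a (rem v s).
Proof.
by elim: s => //= x s IH; rewrite (inj_eq (inv_inj aK)) IH; case: ifP.
Qed.

Lemma subdivide_map g s : subdivide (fun r => g (map a r)) s = subdivide g (map a s).
Proof.
elim/simplex_ind: s g => [|s s0 IH] g; first by rewrite !subdivide_nil.
rewrite !subdivideE ?size_map // big_map bary_map !big_seq.
apply: eq_bigr => v vs; rewrite rem_map_inj /=.
exact: (IH v vs (fun r => g (a (bary s) :: r))).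
Qed.

Lemma symmetric_map g : symmetric_cochain g -> symmetric_cochain (fun r => g (map a r)).
Proof. by move=> sg s r sr; apply/sg/perm_map. Qed.

Section Octahedron.
Variables (J : eqType) (e : J -> T).

(** [octahedron js g] is the sum of [g] over the facets of the octahedral sphere
    with vertices [e j] and [a (e j)] for [j] in [js], built as the successive
    suspensions of the empty simplex. *)
Fixpoint octahedron (js : seq J) g : bool :=
  if js is j :: js' then
    octahedron js' (fun r => g (e j :: r)) (+)
    octahedron js' (fun r => g (map a (e j :: r)))
  else g [::].

Lemma eq_octahedron js g h : g =1 h -> octahedron js g = octahedron js h.
Proof.
by elim: js g h => [|j js IH] g h gh //=; congr (_ (+) _); apply: IH => r; apply: gh.
Qed.

Lemma octahedron_add js g h :
  octahedron js (fun r => g r (+) h r) = octahedron js g (+) octahedron js h.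
Proof. by elim: js g h => [|j js IH] g h //=; rewrite !IH addbACA. Qed.

Lemma octahedron_map js g : octahedron js (fun r => g (map a r)) = octahedron js g.
Proof.
case: js => [//|j js] /=; rewrite addbC; congr (_ (+) _).
by apply: eq_octahedron => r; rewrite aK -map_comp (eq_map aK) map_id.
Qed.

(** The octahedral sphere is a cycle: the two cones of a suspension have the
    same boundary, because the antipode preserves the equator. *)
Lemma octahedron_cycle js g : symmetric_cochain g -> octahedron js (coboundary g) = false.
Proof.
elim: js g => [|j js IH] g sg /=; first exact: big_nil.
have sga := symmetric_map sg.
rewrite (eq_octahedron js (fun r => coboundary_cons (e j) r sg)).
rewrite -(eq_octahedron js (fun r => coboundary_map a (e j :: r) sg)).
rewrite (eq_octahedron js (fun r => coboundary_cons (e j) r sga)).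
rewrite !octahedron_add octahedron_map !IH ?addbF ?addbb //.
all: by [exact: symmetric_cons|exact: (symmetric_cons (e j) sga)].
Qed.

Lemma octahedron_cone j js g : symmetric_cochain g ->
  octahedron js (fun r => coboundary g (e j :: r)) = octahedron js g.
Proof.
move=> sg; rewrite (eq_octahedron js (fun r => coboundary_cons (e j) r sg)).
by rewrite octahedron_add octahedron_cycle ?addbF //; exact: symmetric_cons.
Qed.

End Octahedron.
End Subdivision.

(** * Alternating labellings *)

Section FanCochain.

(* A signed label is a natural number: twice its absolute value, plus its sign. *)
Implicit Types (x y : nat) (w c : seq nat).

Fixpoint alternating (b : bool) w : bool :=
  if w is x :: w' then (odd x == b) && alternating (~~ b) w' else true.

Definition fan b c := alternating b (sort leq c).

Definition flip_sign x := (x./2).*2 + ~~ odd x.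

Definition complement_free c := {in c &, injective half}.

Lemma fan_symmetric b : symmetric_cochain (fan b).
Proof.
move=> s r sr; congr alternating.
by apply/perm_sortP => //; [exact: leq_total|exact: leq_trans|exact: anti_leq].
Qed.

Lemma coboundary_alternating b w : sorted leq w ->
  coboundary (alternating b) w = alternating b w (+) alternating (~~ b) w.
Proof.
elim: w b => [|x w IH] b; first by rewrite /coboundary big_nil.
move=> sxw; have sw := path_sorted sxw.
have xw : all (leq x) w by apply: order_path_min sxw; exact: leq_trans.
rewrite /coboundary big_cons /= eqxx.
have -> : \big[addb/false]_(v <- w)
      alternating b (if x == v then w else x :: rem v w) =
    \big[addb/false]_(v <- w) ((odd x == b) && alternating (~~ b) (rem v w)).
  rewrite !big_seq; apply: eq_bigr => v vw; case: eqVneq => // xv.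
  (* A repeated smallest label must come first, by sortedness. *)
  subst v; suff {1}-> : w = x :: rem x w by [].
  case: w vw xw sw {IH sxw} => //= y w; rewrite in_cons eq_sym.
  case: eqVneq => [->//|yx] /= xw /andP[xy _] syw.
  have /allP/(_ _ xw) yx' : all (leq y) w by apply: order_path_min syw; exact: leq_trans.
  by rewrite (@anti_leq x y) ?eqxx ?xy ?yx' // in yx.
case: (odd x =P b) => [xb|/eqP xb] /=.
  rewrite -/(coboundary (alternating (~~ b)) w) IH // negbK xb.
  by case: b {IH xb} => /=; rewrite addbF addbC -addbA addbb addbF.
rewrite big1_eq addbF.
by case: b {IH} xb => /=; case: (odd x).
Qed.

(** Fan's parity identity: deleting an entry of a non-alternating word leaves an
    alternating word in an even number of ways, and deleting one from an alternating
    word leaves an alternating word starting with [b] only for one of its two ends. *)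
Lemma coboundary_fan b c : coboundary (fan b) c = fan b c (+) fan (~~ b) c.
Proof.
have /(coboundary_symmetric (@fan_symmetric b)) -> : perm_eq c (sort leq c).
  by rewrite perm_sym perm_sort.
rewrite /fan -coboundary_alternating; last by apply: sort_sorted; exact: leq_total.
apply: eq_bigr => v _; congr alternating; apply: sorted_sort; first exact: leq_trans.
apply: (subseq_sorted leq_trans (rem_subseq _ _)).
by apply: sort_sorted; exact: leq_total.
Qed.

Lemma odd_flip_sign x : odd (flip_sign x) = ~~ odd x.
Proof. by rewrite /flip_sign oddD odd_double; case: (odd x). Qed.

Lemma fan_flip_sign b c : complement_free c -> fan b (map flip_sign c) = fan (~~ b) c.
Proof.
move=> cf; rewrite /fan.
have cfs : {in sort leq c &, injective half}.
  by move=> x y; rewrite !mem_sort; exact: cf.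
have -> : sort leq (map flip_sign c) = map flip_sign (sort leq c).
  have le_flip : {in sort leq c &, {homo flip_sign : x y / (x <= y)%N}}.
    move=> x y xc yc; have xy := cfs _ _ xc yc.
    rewrite /flip_sign -{1}(odd_double_half x) -{1}(odd_double_half y).
    have [/xy ->|] := eqVneq (x./2) (y./2); first by rewrite !leqnn.
    by case: (odd x) (odd y) => -[]; lia.
  apply: (sorted_eq leq_trans anti_leq).
  - by apply: sort_sorted; exact: leq_total.
  - by apply: (homo_sorted_in le_flip); [exact/allP|apply: sort_sorted; exact: leq_total].
  - by rewrite perm_sort perm_map // perm_sym perm_sort.
elim: (sort leq c) b {cfs} => //= x w IH b; rewrite IH odd_flip_sign.
by case: b; case: (odd x).
Qed.

(** An alternating word of labels without complementary pairs has distinct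
    absolute values, so it is no longer than the number of values available. *)
Lemma fan_pigeonhole b c m : complement_free c ->
  (forall x, x \in c -> (x./2 < m)%N) -> (m < size c)%N -> fan b c = false.
Proof.
move=> cf cm mc; apply: contraTF mc => fc; rewrite -leqNgt -(size_sort leq).
have cfs : {in sort leq c &, injective half}.
  by move=> x y; rewrite !mem_sort; exact: cf.
have {}cm x : x \in sort leq c -> (x./2 < m)%N by rewrite mem_sort; apply: cm.
have : sorted leq (sort leq c) by apply: sort_sorted; exact: leq_total.
move: fc; rewrite /fan; move: (sort leq c) cfs cm => w cfs cm fw sw.
suff sh : sorted ltn (map half w).
  rewrite -(size_map half) -(size_iota 0 m); apply: uniq_leq_size.
    exact: sorted_uniq ltn_trans ltnn _ sh.
  by move=> _ /mapP[x xw ->]; rewrite mem_iota cm.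
elim: w b cfs fw sw {c cf cm} => [//|x [//|y w]] IH b cfs.
move=> /=/and3P[/eqP xb /eqP yb fw] /andP[xy syw].
apply/andP; split.
  rewrite ltn_neqAle half_leq // andbT; apply/eqP => hxy.
  have xey : x = y by apply: cfs; rewrite ?inE ?eqxx ?orbT.
  by move: yb; rewrite -xey xb; case: b {xb fw}.
apply: (IH (~~ b)) => //=; last by rewrite yb eqxx.
by move=> u v uw vw; apply: cfs; rewrite in_cons ?uw ?vw orbT.
Qed.

End FanCochain.

(** * Barycentric subdivision in a normed space *)

Section Mesh.
Variables (R : realType) (V : normedModType R).
Implicit Types (s r : seq V) (Q : V -> Prop) (D rho : R) (n t : nat).

Definition barycenter s : V := (size s)%:R^-1 *: \sum_(v <- s) v.

Definition barycentrically_convex Q :=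
  forall s, (0 < size s)%N -> {in s, forall v, Q v} -> Q (barycenter s).

Definition mesh_le D s := {in s &, forall v w, `|v - w| <= D}.

Lemma perm_barycenter s r : perm_eq s r -> barycenter s = barycenter r.
Proof. by move=> sr; rewrite /barycenter (perm_size sr) (perm_big _ sr). Qed.

Lemma barycenter_map_opp s : barycenter (map -%R s) = - barycenter s.
Proof. by rewrite /barycenter size_map big_map sumrN scalerN. Qed.

Lemma sum_le_const (F : V -> R) s D : {in s, forall v, F v <= D} ->
  \sum_(v <- s) F v <= D *+ size s.
Proof.
elim: s => [|v s IH] sD; first by rewrite big_nil.
rewrite big_cons mulrS lerD ?sD ?mem_head // IH // => w ws.
by rewrite sD // in_cons ws orbT.
Qed.

Lemma norm_barycenterB_le s v : (0 < size s)%N ->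
  `|v - barycenter s| <= (size s)%:R^-1 * \sum_(w <- s) `|v - w|.
Proof.
move=> s0; have n0 : (size s)%:R != 0 :> R by rewrite pnatr_eq0 -lt0n.
have -> : v - barycenter s = (size s)%:R^-1 *: \sum_(w <- s) (v - w).
  rewrite sumrB scalerBr; congr (_ - _).
  by rewrite big_const_seq count_predT iter_addr_0 -(scaler_nat _ v) scalerA mulVf ?scale1r.
by rewrite normrZ ger0_norm ?invr_ge0 // ler_wpM2l ?invr_ge0 // ler_norm_sum.
Qed.

Lemma ball_barycentrically_convex c D : barycentrically_convex (fun v => `|c - v| <= D).
Proof.
move=> s s0 sD; apply: (le_trans (norm_barycenterB_le c s0)).
have n0 : 0 < (size s)%:R :> R by rewrite ltr0n.
rewrite mulrC ler_pdivrMr // mulr_natr.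
exact: sum_le_const.
Qed.

(** One of the differences averaged in [v - barycenter s] vanishes, which gains
    the factor [1 - 1/n]. *)
Lemma norm_barycenter_vertex D s v n : mesh_le D s -> v \in s -> (size s <= n)%N ->
  `|v - barycenter s| <= (1 - n%:R^-1) * D.
Proof.
move=> sD vs sn; have s0 : (0 < size s)%N by case: s vs {sD sn}.
have D0 : 0 <= D by have := sD v v vs vs; rewrite subrr normr0.
have n0 : 0 < (size s)%:R :> R by rewrite ltr0n.
apply: (le_trans (norm_barycenterB_le v s0)).
apply: (@le_trans _ _ ((1 - (size s)%:R^-1) * D)); last first.
  by rewrite ler_wpM2r // lerB // lef_pV2 ?posrE ?ler_nat ?ltr0n // (leq_trans s0).
rewrite (perm_big _ (perm_to_rem vs)) big_cons /= subrr normr0 add0r.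
have -> : (1 - (size s)%:R^-1) * D = (size s)%:R^-1 * (D *+ (size s).-1).
  rewrite -(mulr_natr D); case: (size s) s0 => // m _ /=; rewrite -natr1.
  by field; rewrite natr1 pnatr_eq0.
rewrite ler_wpM2l ?invr_ge0 // -(size_rem vs).
by apply: sum_le_const => w /mem_rem; apply: sD.
Qed.

(** The simplices of the subdivision of [s] lie in every convex set that contains
    [s], and their mesh is smaller by the factor [1 - 1/n]: the two facts needed
    about subdivision, in terms of the cochains evaluated on it. *)
Lemma eq_subdivide_mesh n Q D s (g h : seq V -> bool) :
  barycentrically_convex Q -> {in s, forall v, Q v} -> mesh_le D s -> (size s <= n)%N ->
  (forall r, size r = size s -> {in r, forall v, Q v} ->
    mesh_le ((1 - n%:R^-1) * D) r -> g r = h r) ->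
  subdivide barycenter g s = subdivide barycenter h s.
Proof.
elim/simplex_ind: s Q g h => [|s s0 IH] Q g h cQ sQ sD sn gh.
  by rewrite !subdivide_nil; exact: gh.
rewrite !subdivideE // !big_seq; apply: eq_bigr => v vs.
set b := barycenter s; set D' := (1 - n%:R^-1) * D.
have sub : {subset rem v s <= s} by apply: mem_rem.
have sz : size (rem v s) = (size s).-1 by rewrite size_rem.
(* The facet also lies in the ball around the apex of radius the new mesh. *)
apply: (IH v vs (fun w => Q w /\ `|b - w| <= D')).
- move=> r r0 rQ; split; first by apply: cQ => // w /rQ[].
  by apply: ball_barycentrically_convex => // w /rQ[].
- move=> w /sub ws; split; first exact: sQ.
  by rewrite distrC; exact: norm_barycenter_vertex.
- by move=> u w /sub us /sub ws; exact: sD.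
- by rewrite sz (leq_trans (leq_pred _)).
- move=> r; rewrite sz => rs rQ rD; apply: gh => [|u|u w].
  + by rewrite /= rs prednK.
  + by rewrite in_cons => /predU1P[->|/rQ[]//]; exact: cQ.
  + have D0 : 0 <= D' by apply: le_trans (norm_barycenter_vertex sD vs sn).
    rewrite !in_cons => /predU1P[->|ur] /predU1P[->|wr].
    * by rewrite subrr normr0.
    * by have [] := rQ w wr.
    * by rewrite distrC; have [] := rQ u ur.
    * exact: rD.
Qed.

Lemma eq_iter_subdivide n t Q D s (g h : seq V -> bool) :
  barycentrically_convex Q -> {in s, forall v, Q v} -> mesh_le D s -> (size s <= n)%N ->
  (forall r, size r = size s -> {in r, forall v, Q v} ->
    mesh_le ((1 - n%:R^-1) ^+ t * D) r -> g r = h r) ->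
  iter t (subdivide barycenter) g s = iter t (subdivide barycenter) h s.
Proof.
move=> cQ; elim: t D s => [|t IH] D s sQ sD sn gh.
  by apply: gh => //; rewrite expr0 mul1r.
rewrite !iterS; apply: (eq_subdivide_mesh cQ sQ sD sn) => r rs rQ rD.
apply: (IH _ r rQ rD); rewrite rs // => u us uQ uD.
by apply: gh => //; rewrite exprSr -mulrA.
Qed.

End Mesh.

Lemma compact_uniformly_continuous (R : realType) (U V : normedModType R) (K : set U)
    (f : U -> V) (e : R) :
  compact K -> {within K, continuous f} -> 0 < e ->
  exists2 del, 0 < del & forall x y, K x -> K y -> `|x - y| < del -> `|f x - f y| < e.
Proof.
move=> /compact_near_coveringP/near_covering_withinP cK /subspace_continuousP cf e0.
pose P (del : R) x := forall y, K y -> `|x - y| < del -> `|f x - f y| < e.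
have : \forall del \near 0^'+, K `<=` P del.
  apply: cK => x Kx.
  have e2 : 0 < e / 2 by rewrite divr_gt0.
  have /cvgrPdist_lt/(_ _ e2) := cf x Kx.
  rewrite /prop_near1 /within /= => /nbhs_ballP[r /= r0 xr].
  have r2 : 0 < r / 2 by rewrite divr_gt0.
  near=> x' del => /= Kx' y Ky x'y.
  have xx' : `|x - x'| < r / 2.
    near: x'; apply/nbhs_ballP; exists (r / 2) => //= z; by rewrite -ball_normE.
  have dr : del < r / 2 by near: del; exact: nbhs_right_lt.
  have fx' : `|f x - f x'| < e / 2.
    by apply: xr => //; rewrite -ball_normE /=; lra.
  have fy : `|f x - f y| < e / 2.
    apply: xr => //; rewrite -ball_normE /=.
    by have := ler_distD x' x y; lra.
  by have := ler_distD (f x) (f x') (f y); rewrite (distrC (f x') (f x)); lra.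
move=> nearK; near (0 : R)^'+ => del.
exists del; first by near: del; exact: nbhs_right_gt.
have KP : K `<=` P del by near: del.
by move=> x y Kx; apply: KP.
Unshelve. all: by end_near. Qed.

Section IteratedSubdivision.
Variables (T : eqType) (bary : seq T -> T).
Hypothesis perm_bary : forall s r, perm_eq s r -> bary s = bary r.
Variable a : T -> T.
Hypothesis aK : involutive a.
Hypothesis bary_map : forall s, bary (map a s) = a (bary s).
Variable t : nat.
Implicit Types (g h : seq T -> bool).
Local Notation sd := (iter t (subdivide bary)).

Lemma iter_subdivide_nil g : sd g [::] = g [::].
Proof. by elim: t => //= n <-. Qed.

Lemma iter_subdivide0 : sd (fun=> false) =1 (fun=> false).
Proof.
elim: t => [//|n IH] s; rewrite iterS (eq_subdivide _ IH).
by rewrite -[RHS](addbb (subdivide bary (fun=> false) s)) -subdivide_add.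
Qed.

Lemma iter_subdivide_add g h s : sd (fun r => g r (+) h r) s = sd g s (+) sd h s.
Proof.
elim: t s => [//|n IH] s; rewrite !iterS -subdivide_add.
exact: (eq_subdivide bary IH).
Qed.

Lemma iter_subdivide_symmetric g : symmetric_cochain g -> symmetric_cochain (sd g).
Proof. by move=> sg; elim: t => [//|n IH]; exact: subdivide_symmetric. Qed.

Lemma iter_subdivide_coboundary g s : symmetric_cochain g ->
  sd (coboundary g) s = coboundary (sd g) s.
Proof.
move=> sg; elim: t s => [//|n IH] s; rewrite !iterS (eq_subdivide _ IH).
apply: subdivide_coboundary => //; elim: n {IH} => [//|n IH].
exact: subdivide_symmetric.
Qed.

Lemma iter_subdivide_map g s : sd (fun r => g (map a r)) s = sd g (map a s).
Proof.
elim: t s => [//|n IH] s.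
by rewrite !iterS (eq_subdivide _ IH) (subdivide_map aK).
Qed.

End IteratedSubdivision.

(** * The octahedral sphere and the Borsuk-Ulam theorem *)

Section OctahedralSphere.
Variables (R : realType) (k : nat).
Implicit Types (v w : 'rV[R]_k) (s r : seq 'rV[R]_k) (js : seq 'I_k) (eps : 'I_k -> bool).

Definition octahedral_sphere : set 'rV[R]_k := [set v | \sum_j `|v 0 j| = 1].

Definition signed_unit eps (j : 'I_k) : 'rV[R]_k := (-1) ^+ eps j *: delta_mx 0 j.

Definition octahedral_facet eps v :=
  (forall j, 0 <= (-1) ^+ eps j * v 0 j) /\ \sum_j (-1) ^+ eps j * v 0 j = 1.

Local Notation unit_vector := (fun j => delta_mx 0 j : 'rV[R]_k).
Local Notation octahedron := (octahedron -%R unit_vector).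
Local Notation sd := (subdivide (@barycenter R 'rV[R]_k)).

Lemma octahedral_facet_sphere eps v : octahedral_facet eps v -> octahedral_sphere v.
Proof.
move=> [v0 v1]; rewrite /octahedral_sphere /= -v1; apply: eq_bigr => j _.
by rewrite -[RHS]ger0_norm // normrMsign.
Qed.

Lemma octahedral_facet_convex eps : barycentrically_convex (octahedral_facet eps).
Proof.
move=> s s0 sQ; have n0 : (size s)%:R != 0 :> R by rewrite pnatr_eq0 -lt0n.
have E j : (-1) ^+ eps j * barycenter s 0 j =
    (size s)%:R^-1 * \sum_(v <- s) (-1) ^+ eps j * v 0 j.
  by rewrite !mxE summxE -mulr_sumr mulrCA.
split=> [j|].
  by rewrite E mulr_ge0 ?invr_ge0 // big_seq sumr_ge0 // => v /sQ[].
rewrite (eq_bigr _ (fun j _ => E j)) -mulr_sumr exchange_big /= big_seq.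
rewrite (eq_bigr (fun=> 1)) => [|v /sQ[]//].
by rewrite -big_seq big_const_seq count_predT iter_addr_0 mulVf.
Qed.

Lemma octahedral_facet_vertex eps j : octahedral_facet eps (signed_unit eps j).
Proof.
have E i : (-1) ^+ eps i * signed_unit eps j 0 i = (i == j)%:R.
  rewrite !mxE eqxx /= mulrA; case: eqVneq => [->|_]; last by rewrite mulr0.
  by rewrite mulr1 -signr_addb addbb.
split=> [i|]; first by rewrite E.
by rewrite (eq_bigr _ (fun i _ => E i)) (bigD1 j) //= eqxx big1 ?addr0 // => i /negPf ->.
Qed.

Lemma octahedral_sphere_norm v : octahedral_sphere v -> `|v| <= 1.
Proof.
rewrite /octahedral_sphere /= => v1; rewrite {1}/Num.norm /= mx_normrE.
apply: bigmax_le => //= -[i j] _ /=; rewrite (ord1 i) -v1 (bigD1 j) //= lerDl.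
exact: sumr_ge0.
Qed.

Lemma compact_octahedral_sphere : compact octahedral_sphere.
Proof.
apply: bounded_closed_compact.
  exists 1; split => // x x1 v vS /=; exact: le_trans (octahedral_sphere_norm vS) (ltW x1).
apply: (@preimage_closed _ _ (fun v : 'rV[R]_k => \sum_j `|v 0 j|) [set 1]).
  move=> v _; apply: (continuous_big (op := +%R)); first exact: add_continuous.
  move=> j _ w; apply: (@continuous_comp _ _ _ (fun v : 'rV[R]_k => v 0 j)).
    exact: coord_continuous.
  exact: norm_continuous.
exact: closed_eq.
Qed.

Lemma signed_unit_cons eps j js : j \notin js ->
  delta_mx 0 j :: map (signed_unit eps) js =
  map (signed_unit (fun i => (i != j) && eps i)) (j :: js).
Proof.
move=> jjs /=; rewrite {2}/signed_unit eqxx expr0 scale1r; congr cons.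
by apply/eq_in_map => i ijs; rewrite /signed_unit; case: eqVneq ijs jjs => [->->|].
Qed.

(** The vertices of a facet of the octahedral sphere are distinct basis vectors with
    arbitrary signs. *)
Lemma eq_octahedron_signs js (g h : seq 'rV[R]_k -> bool) : uniq js ->
  (forall eps, g (map (signed_unit eps) js) = h (map (signed_unit eps) js)) ->
  octahedron js g = octahedron js h.
Proof.
elim: js g h => [|j js IH] g h; first by move=> _ /(_ (fun=> false)).
move=> /= /andP[jjs ujs] gh; congr (_ (+) _); apply: IH => // eps.
- by rewrite signed_unit_cons //; exact: gh.
- have := gh (fun i => (i == j) || ~~ eps i).
  rewrite {1 3}/signed_unit eqxx /= expr1 scaleN1r.
  suff -> : map (signed_unit (fun i => (i == j) || ~~ eps i)) js =
      map -%R (map (signed_unit eps) js) by [].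
  rewrite -map_comp; apply/eq_in_map => i ijs; rewrite /signed_unit /=.
  case: eqVneq ijs jjs => [->->//|_ _ _].
  by rewrite signrN scaleNr.
Qed.

(** The simplices of the iterated subdivision of a facet of the octahedral sphere
    stay on the sphere, because the facet is convex, and their mesh tends to
    0 as [t] grows. *)
Lemma eq_iter_subdivide_signs t js eps (g h : seq 'rV[R]_k -> bool) : uniq js ->
  (forall r, size r = size js -> {in r, forall v, octahedral_sphere v} ->
    mesh_le ((1 - k%:R^-1) ^+ t * 2) r -> g r = h r) ->
  iter t sd g (map (signed_unit eps) js) = iter t sd h (map (signed_unit eps) js).
Proof.
move=> ujs gh.
have vert v : v \in map (signed_unit eps) js -> octahedral_facet eps v.
  by case/mapP => j _ ->; exact: octahedral_facet_vertex.
apply: (@eq_iter_subdivide _ _ k t (octahedral_facet eps) 2).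
- exact: octahedral_facet_convex.
- by move=> v /vert.
- move=> v w /vert/octahedral_facet_sphere/octahedral_sphere_norm v1.
  move=> /vert/octahedral_facet_sphere/octahedral_sphere_norm w1.
  by apply: le_trans (ler_normB _ _) _; rewrite -[2]/(1 + 1) lerD.
- by rewrite size_map -(card_uniqP ujs) -[leqRHS]card_ord max_card.
- move=> r; rewrite size_map => rjs rQ rD; apply: gh => // v /rQ.
  exact: octahedral_facet_sphere.
Qed.

End OctahedralSphere.

Section BorsukUlam.
Variables (R : realType) (k : nat).
Local Notation unit_vector := (fun j => delta_mx 0 j : 'rV[R]_k).
Local Notation octahedron := (octahedron -%R unit_vector).
Local Notation sd := (subdivide (@barycenter R 'rV[R]_k)).
Local Notation sphere := (@octahedral_sphere R k).

(** Fan's theorem for an antipodal labelling [code] of the octahedral sphere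
    without complementary pairs at the scale of the [t]-th subdivision: that
    subdivision contains an odd number of alternating simplices. *)
Lemma octahedron_fan (code : 'rV[R]_k -> nat) t js : uniq js ->
  (forall v, sphere v -> code (- v) = flip_sign (code v)) ->
  (forall r, {in r, forall v, sphere v} -> mesh_le ((1 - k%:R^-1) ^+ t * 2) r ->
    complement_free (map code r)) ->
  octahedron js (iter t sd (fun r => fan true (map code r))) = true.
Proof.
move=> ujs codeN cf; set phi := (fun r => fan true (map code r)).
have sphi : symmetric_cochain phi.
  by move=> s r sr; apply: fan_symmetric; exact: perm_map.
have oppK : involutive (-%R : 'rV[R]_k -> _) by exact: opprK.
have pb := @perm_barycenter R 'rV[R]_k.
(* The sphere is made of a cone and its antipode, so the sum of [phi] over it is the
   sum of [phi] plus its antipode over the cone.  This is the coboundary of [phi],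
   whose sum over the cone is the sum of [phi] over the equator. *)
elim: js ujs => [_|j js IH ujs]; first by rewrite /= iter_subdivide_nil.
have /IH <- : uniq js by case/andP: ujs.
have jjs : j \notin js by case/andP: ujs.
rewrite -[RHS](octahedron_cone (a := -%R) oppK unit_vector j); last first.
  exact: iter_subdivide_symmetric.
rewrite /= -octahedron_add; apply: eq_octahedron_signs => [|eps].
  by case/andP: ujs.
rewrite -(map_cons -%R) signed_unit_cons // -iter_subdivide_coboundary //.
rewrite -(iter_subdivide_map oppK); last exact: barycenter_map_opp.
rewrite -iter_subdivide_add; apply: eq_iter_subdivide_signs => // r _ rS rD.
rewrite /phi (coboundary_map code); last exact: fan_symmetric.
rewrite coboundary_fan -fan_flip_sign; last exact: cf.
congr (_ (+) fan _ _); rewrite -!map_comp; apply/eq_in_map => v /rS vS /=.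
by rewrite codeN.
Qed.

(** The Borsuk-Ulam theorem.  A unit vector of R^m has a coordinate of square at
    least 1/(m+1); its index and sign label the points of the sphere, and by
    uniform continuity close points do not carry opposite labels.  If [m < k], no
    simplex with [k] vertices is alternating, against Fan's theorem. *)
Theorem borsuk_ulam m (f : 'rV[R]_k -> 'cV[R]_m) :
  {within sphere, continuous f} ->
  (forall v, sphere v -> unit_sphere (f v)) ->
  (forall v, sphere v -> f (- v) = - f v) -> (k <= m)%N.
Proof.
move=> cf f1 fN; rewrite leqNgt; apply/negP => mk.
have k0 : (0 < k)%N by apply: leq_trans mk.
pose c : R := m.+1%:R; have c0 : 0 < c by rewrite ltr0n.
have half_code (l : 'I_m) (b : bool) : (l.*2 + b)%N./2 = l.
  by rewrite halfD odd_double doubleK; case: b; rewrite /= ?addn0.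
have odd_code (l : 'I_m) (b : bool) : odd (l.*2 + b)%N = b.
  by rewrite oddD odd_double; case: b.
pose code v := if [pick i | 1 <= c * f v i 0 ^+ 2] is Some i
  then (i.*2 + (f v i 0 < 0)%R)%N else 0%N.
have codeP v : sphere v -> exists2 i : 'I_m, 1 <= c * f v i 0 ^+ 2 &
    code v = (i.*2 + (f v i 0 < 0)%R)%N.
  move=> vS; rewrite /code; case: pickP => [i fi|nf]; first by exists i.
  have : c <= m%:R.
    rewrite -[c]mulr1 -[X in c * X](f1 v vS) mulr_sumr.
    rewrite -[m in leRHS]card_ord -sumr_const; apply: ler_sum => i _.
    by have := nf i; rewrite real_leNgt ?num_real // => /negbFE/ltW.
  by rewrite ler_nat ltnn.
have codeN v : sphere v -> code (- v) = flip_sign (code v).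
  move=> vS; have := codeP _ vS; rewrite /code fN //.
  have -> : [pick i | 1 <= c * (- f v) i 0 ^+ 2] = [pick i | 1 <= c * f v i 0 ^+ 2].
    by apply: eq_pick => i; rewrite mxE sqrrN.
  case: pickP => [i fi _|nf [i]]; last by rewrite nf.
  rewrite mxE oppr_lt0 /flip_sign half_code odd_code -leNgt; congr (_ + nat_of_bool _)%N.
  have fi0 : f v i 0 != 0.
    by apply: contraTneq fi => ->; rewrite expr0n mulr0 -ltNge.
  by rewrite lt_neqAle eq_sym fi0.
have e0 : 0 < c^-1 by rewrite invr_gt0.
have [del del0 fdel] := compact_uniformly_continuous (@compact_octahedral_sphere R k)
   cf e0.
have [t tdel] : exists t, (1 - k%:R^-1) ^+ t * 2 < del :> R.
  have k1 : `|1 - k%:R^-1| < 1 :> R.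
    have k1 : (k%:R^-1 : R) <= 1 by rewrite invf_le1 ?ler1n ?ltr0n.
    by rewrite ger0_norm ?subr_ge0 // gtrBl invr_gt0 ltr0n.
  have /cvgrPdist_lt/(_ (del / 2)) := cvg_expr k1.
  rewrite divr_gt0 // => /(_ isT) [t _ /(_ t (leqnn t))] /=.
  rewrite sub0r normrN => ht; exists t; rewrite -ltr_pdivlMr //.
  by apply: le_lt_trans ht; exact: ler_norm.
have compf r : {in r, forall v, sphere v} -> mesh_le ((1 - k%:R^-1) ^+ t * 2) r ->
    complement_free (map code r).
  move=> rS rD _ _ /mapP[v vr ->] /mapP[w wr ->].
  have [i fi ->] := codeP _ (rS _ vr); have [j fj ->] := codeP _ (rS _ wr).
  rewrite !half_code => /val_inj ij; subst j; congr (_ + nat_of_bool _)%N.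
  have := fdel v w (rS _ vr) (rS _ wr) (le_lt_trans (rD _ _ vr wr) tdel).
  have lb (x : R) : 1 <= c * x ^+ 2 -> c^-1 <= `|x|.
    move=> cx; rewrite -[leLHS]mul1r ler_pdivrMr // mulrC.
    have [x1|x1] := ltP `|x| 1; last first.
      by apply: (le_trans x1); rewrite ler_peMl // ler1n.
    apply: (le_trans cx); rewrite ler_pM2l // -(ger0_norm (sqr_ge0 x)) normrX expr2.
    by rewrite ler_piMr // ltW.
  have coord : `|f v i 0 - f w i 0| <= `|f v - f w|.
    rewrite [leRHS]/Num.norm /= mx_normrE.
    by apply: (le_trans _ (le_bigmax _ _ (i, 0))); rewrite /= !mxE.
  have opp_far x y : x < 0 -> 0 <= y -> c^-1 <= `|x| -> c^-1 <= `|x - y|.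
    move=> x0 y0; rewrite ltr0_norm // ltr0_norm; last by lra.
    by move=> /le_trans; apply; rewrite opprB lerDr.
  have := lb _ fi; have := lb _ fj => ey ex /(le_lt_trans coord).
  case: (ltP (f v i 0) 0) (ltP (f w i 0) 0) => [x0|x0] [y0|y0] //.
    by rewrite ltNge opp_far.
  by rewrite ltNge distrC opp_far.
have zero : octahedron (enum 'I_k) (iter t sd (fun r => fan true (map code r))) = false.
  rewrite (eq_octahedron_signs (h := fun=> false)) ?enum_uniq // => [|eps].
    by rewrite -[RHS](addbb (octahedron (enum 'I_k) (fun=> false))) -octahedron_add.
  rewrite -(iter_subdivide0 (@barycenter R 'rV[R]_k) t (map (signed_unit R eps) (enum 'I_k))).
  apply: eq_iter_subdivide_signs => [|r rk rS rD]; first exact: enum_uniq.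
  apply: (@fan_pigeonhole _ _ m).
  - exact: compf.
  - move=> _ /mapP[v /rS /codeP[i _ ->] ->].
    by rewrite half_code.
  - by rewrite size_map rk size_enum_ord.
by move: (octahedron_fan (enum_uniq 'I_k) codeN compf); rewrite zero.
Qed.

End BorsukUlam.

(** * Tangents to the power function and the power mean inequality *)

Section PowerInequalities.
Variables (R : realType) (p : R).
Implicit Types (a b u : R).

Lemma ln_lt_sub1 u : 0 < u -> u != 1 -> ln u < u - 1.
Proof.
move=> u0 u1; rewrite ltrBrDl -[ltRHS]lnK ?posrE //.
by apply: expR_gt1Dx; rewrite ln_eq0.
Qed.

Lemma ln_le_sub1 u : 0 < u -> ln u <= u - 1.
Proof.
by move=> u0; have [->|/(ln_lt_sub1 u0)/ltW//] := eqVneq u 1; rewrite ln1 subrr.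
Qed.

(** Bernoulli's inequality is the weighted arithmetic-geometric mean inequality
    for [1 + p (u - 1)] and [1], whose weighted mean is [u]: apply
    [ln z <= z - 1] to both numbers divided by their mean. *)
Lemma bernoulli_powR u : 1 < p -> 0 < u -> u != 1 -> 1 + p * (u - 1) < u `^ p.
Proof.
move=> p1 u0 u1; set v := 1 + p * (u - 1).
have [v0|v0] := leP v 0; first by apply: le_lt_trans v0 _; exact: powR_gt0.
rewrite /powR gt_eqF // -[ltLHS]lnK ?posrE // ltr_expR.
have lnv : ln v - ln u <= v / u - 1.
  by rewrite -ln_div ?posrE //; apply: ln_le_sub1; exact: divr_gt0.
have lnu : - ln u < u^-1 - 1.
  by rewrite -lnV ?posrE //; apply: ln_lt_sub1; rewrite ?invr_gt0 ?invr_eq1.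
have mean : (v / u - 1) + (p - 1) * (u^-1 - 1) = 0.
  by rewrite /v; field; exact: lt0r_neq0.
have : (p - 1) * (- ln u) < (p - 1) * (u^-1 - 1) by rewrite ltr_pM2l ?subr_gt0.
by move: lnv mean; rewrite mulrBl mul1r; move: (v / u - 1) => z; lra.
Qed.

(** The derivative of [`|a| `^ p]. *)
Definition slope a : R := p * (Num.sg a * `|a| `^ (p - 1)).

Definition tangent_gap a b : R := `|b| `^ p - (`|a| `^ p + slope a * (b - a)).

Lemma slopeN a : slope (- a) = - slope a.
Proof. by rewrite /slope sgrN normrN mulNr mulrN. Qed.

Lemma tangent_gapN a b : tangent_gap (- a) (- b) = tangent_gap a b.
Proof. by rewrite /tangent_gap slopeN !normrN; congr (_ - (_ + _)); ring. Qed.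

Lemma tangent_gap_gt0 a b : 1 < p -> a != b -> 0 < tangent_gap a b.
Proof.
move=> p1; have p0 : 0 < p by apply: lt_trans p1.
wlog : a b / 0 <= a => [H|].
  have [a0|a0] := leP 0 a; first exact: H.
  rewrite -tangent_gapN => ab.
  by apply: H; rewrite ?oppr_ge0 ?ltW // eqr_opp.
rewrite le_eqVlt => /predU1P[<-|a0] ab.
  rewrite /tangent_gap /slope sgr0 normr0 powR0 ?gt_eqF // mul0r mulr0 mul0r addr0 subr0.
  by rewrite powR_gt0 // normr_gt0 eq_sym.
rewrite /tangent_gap /slope gtr0_sg // mul1r (gtr0_norm a0) subr_gt0.
have -> : a `^ p = a * a `^ (p - 1) by rewrite mulr_powRB1 // ltW.
have ap0 : 0 < a `^ (p - 1) by rewrite powR_gt0.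
have [b0|b0] := leP b 0.
  apply: lt_le_trans (powR_ge0 _ _).
  have -> : a * a `^ (p - 1) + p * a `^ (p - 1) * (b - a) =
    a `^ (p - 1) * (p * b - (p - 1) * a) by ring.
  rewrite pmulr_rlt0 // subr_lt0; apply: (@le_lt_trans _ _ 0).
    by rewrite mulr_ge0_le0 // ltW.
  by rewrite mulr_gt0 ?subr_gt0.
have u0 : 0 < b / a by exact: divr_gt0.
have u1 : b / a != 1.
  by apply: contra_neq ab => ba; rewrite -(divfK (lt0r_neq0 a0) b) ba mul1r.
rewrite (gtr0_norm b0) -{2}(divfK (lt0r_neq0 a0) b) powRM ?ltW //.
rewrite -(mulr_powRB1 (ltW a0) p0).
have -> : a * a `^ (p - 1) + p * a `^ (p - 1) * (b - a) =
    (1 + p * (b / a - 1)) * (a * a `^ (p - 1)).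
  by field; exact: lt0r_neq0.
by rewrite ltr_pM2r ?mulr_gt0 // bernoulli_powR.
Qed.

Lemma tangent_gap_ge0 a b : 1 <= p -> 0 <= tangent_gap a b.
Proof.
rewrite le_eqVlt => /predU1P[p1|p1].
  rewrite /tangent_gap /slope -p1 subrr !powRr1 ?normr_ge0 // powRr0 mulr1 mul1r.
  rewrite mulrBr -normrEsg addrCA subrr addr0 subr_ge0.
  apply: le_trans (ler_norm _) _; rewrite normrM normr_sg.
  by case: (a != 0); rewrite ?mul1r ?mul0r.
have [->|/(tangent_gap_gt0 p1)/ltW//] := eqVneq a b.
by rewrite /tangent_gap subrr mulr0 addr0 subrr.
Qed.

(** The defect in the power mean inequality for the numbers [x i] is the sum of
    their gaps above the tangent at the mean, so it is nonnegative, and for [1 < p]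
    it vanishes only if all the [x i] agree. *)
Lemma power_mean_gap (I : finType) (A : {set I}) (x : I -> R) : 1 <= p -> (0 < #|A|)%N ->
  #|A|%:R `^ (p - 1) * \sum_(i in A) `|x i| `^ p - `|\sum_(i in A) x i| `^ p =
  #|A|%:R `^ (p - 1) * \sum_(i in A) tangent_gap (#|A|%:R^-1 * \sum_(j in A) x j) (x i).
Proof.
move=> p1 A0; have n0 : 0 < #|A|%:R :> R by rewrite ltr0n.
set m := _^-1 * _.
have S : \sum_(i in A) x i = #|A|%:R * m by rewrite /m mulrA divff ?mul1r ?gt_eqF.
have p0 : 0 < p by apply: lt_le_trans p1.
rewrite S normrM (gtr0_norm n0) powRM ?normr_ge0 ?ltW //.
rewrite -(mulr_powRB1 (ltW n0) p0).
rewrite sumrB big_split /= -mulr_sumr sumrB S !sumr_const.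
rewrite -(mulr_natl m) -(mulr_natl (`|m| `^ p)) subrr mulr0 addr0.
by ring.
Qed.

Lemma power_mean_le (I : finType) (A : {set I}) (x : I -> R) : 1 <= p -> (0 < #|A|)%N ->
  `|\sum_(i in A) x i| `^ p <= #|A|%:R `^ (p - 1) * \sum_(i in A) `|x i| `^ p.
Proof.
move=> p1 A0; rewrite -subr_ge0 power_mean_gap // mulr_ge0 ?powR_ge0 //.
by apply: sumr_ge0 => i _; exact: tangent_gap_ge0.
Qed.

Lemma power_mean_eq (I : finType) (A : {set I}) (x : I -> R) i j : 1 < p ->
  `|\sum_(i in A) x i| `^ p = #|A|%:R `^ (p - 1) * \sum_(i in A) `|x i| `^ p ->
  i \in A -> j \in A -> x i = x j.
Proof.
move=> p1 e iA jA; have A0 : (0 < #|A|)%N by apply/card_gt0P; exists i.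
have := power_mean_gap x (ltW p1) A0; rewrite -e subrr => /esym/eqP.
rewrite mulf_eq0 gt_eqF ?powR_gt0 ?ltr0n //= psumr_eq0; last first.
  by move=> l _; apply: tangent_gap_ge0; exact: ltW.
set m := _^-1 * _ => /allP gap0.
have mean l : l \in A -> x l = m.
  move=> lA; apply/eqP; apply: contraTT (gap0 l (mem_index_enum _)); rewrite eq_sym => lm.
  by rewrite lA /= gt_eqF // tangent_gap_gt0.
by rewrite !mean.
Qed.

End PowerInequalities.

(** * Subgradients of homogeneous functions *)

Section Subgradients.
Variables (R : realType) (n : nat) (p : R).
Implicit Types (F G : 'cV[R]_n -> R) (x g : 'cV[R]_n).

Definition homogeneous F := forall (t : R) x, 0 < t -> F (t *: x) = t `^ p * F x.

(** Along the ray through [x], the subgradient inequality says that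
    [t `^ p * F x - t * c], with [c] the pairing of [g] with [x], is least at
    [t = 1]; its derivative vanishes there. *)
Lemma euler_subgradient F x g : 1 <= p -> homogeneous F -> subdifferential F x g ->
  \sum_i g i 0 * x i 0 = p * F x.
Proof.
move=> p1 hF sg; set c := \sum_i _.
pose h := (fun t : R => t `^ p * F x - t * c).
have dh (t : R) : 0 < t -> is_derive t 1 h (p * t `^ (p - 1) * F x - c).
  move=> t0; have dp := is_derive1_powR p t0.
  rewrite /h; apply: is_derive_eq; rewrite !scaler0 !add0r.
  by rewrite /GRing.scale /=; ring.
have min1 t : t \in `]0, 2[%R -> h 1 <= h t.
  rewrite in_itv /= => /andP[t0 _].
  have := sg (t *: x); rewrite hF // /h powR1 !mul1r => /= h1.
  rewrite lerBlDl; move: h1; rewrite (eq_bigr (fun i => (t - 1) * (g i 0 * x i 0))).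
    by rewrite -mulr_sumr -/c; lra.
  by move=> i _; rewrite mxE; ring.
have d1 := dh 1 ltr01.
have [] : is_derive (1 : R) 1 h 0.
  apply: (@derive1_at_min _ h 0 2) => //.
    by move=> t; rewrite in_itv /= => /andP[/dh[]].
  by rewrite in_itv /= ltr01 ltr1n.
move=> _ d0; case: d1 => _; rewrite d0 powR1 mulr1 => /esym/eqP.
by rewrite subr_eq0 => /eqP.
Qed.

Lemma eigenvector_quotient F G lam x : 1 <= p -> homogeneous F -> homogeneous G ->
  eigenvectors F G lam x -> F x = lam * G x.
Proof.
move=> p1 hF hG [_ [g [Fg [h Gh gh]]]].
have p0 : p != 0 by rewrite gt_eqF // (lt_le_trans _ p1).
apply: (mulfI p0); rewrite -(euler_subgradient p1 hF Fg) mulrCA.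
rewrite -(euler_subgradient p1 hG Gh) mulr_sumr; apply: eq_bigr => i _.
by rewrite -gh mxE mulrA.
Qed.

End Subgradients.

(** * Signs of the boundary map *)

Section BoundarySigns.
Variable V : finType.
Implicit Types (s t : seq V) (x : V).

Lemma map_nth_index s t : uniq s -> size s = size t ->
  map (fun x => nth x t (index x s)) s = t.
Proof.
case: s => [|x0 s] us sz; first by move: sz => /esym/size0nil ->.
apply: (@eq_from_nth _ x0); first by rewrite size_map.
move=> i; rewrite size_map => lt_i; rewrite (nth_map x0) // index_uniq //.
by apply: set_nth_default; rewrite -sz.
Qed.

Lemma reordering_perm s t : uniq s -> perm_eq s t ->
  exists2 q : {perm V}, perm_on [set x in s]%SET q & map q s = t.
Proof.
move=> us st; have ut : uniq t by rewrite -(perm_uniq st).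
have sz := perm_size st.
pose f x := if x \in s then nth x t (index x s) else x.
have f_in x : x \in s -> f x \in s.
  by move=> xs; rewrite /f xs (perm_mem st) mem_nth // -sz index_mem.
have finj : injective f.
  move=> x y; have [xs|xs] := boolP (x \in s); have [ys|ys] := boolP (y \in s).
  - rewrite /f xs ys (set_nth_default y x) -?sz ?index_mem // => /eqP.
    by rewrite nth_uniq -?sz ?index_mem // => /eqP/index_inj; apply.
  - by move=> fxy; have := f_in _ xs; rewrite fxy {1}/f (negPf ys) (negPf ys).
  - by move=> fxy; have := f_in _ ys; rewrite -fxy {1}/f (negPf xs) (negPf xs).
  - by rewrite /f (negPf xs) (negPf ys).
exists (perm finj).
  by apply/fintype.subsetP => x; rewrite !inE permE /f; case: ifP => // _; rewrite eqxx.
rewrite -[RHS](map_nth_index us sz); apply/eq_in_map => x xs.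
by rewrite permE /f xs.
Qed.

Lemma orient_sign_neq0 s t : uniq s -> perm_eq s t ->
  exists b : bool, orient_sign s t = (-1) ^+ b.
Proof.
move=> us st; have [q q_on qst] := reordering_perm us st.
rewrite /orient_sign; case: pickP => [q' _|/(_ q)]; first by exists (odd_perm q').
by rewrite q_on qst eqxx.
Qed.

Lemma orient_sign_eq0 s t : uniq s -> ~~ perm_eq s t -> orient_sign s t = 0.
Proof.
move=> us; apply: contraNeq; rewrite /orient_sign; case: pickP => [q|]; last by rewrite eqxx.
case/andP => q_on /eqP <- _; rewrite perm_sym.
have uqs : uniq (map q s) by rewrite map_inj_uniq //; exact: perm_inj.
have sub : {subset map q s <= s}.
  by move=> _ /mapP[x xs ->]; have := perm_closed x q_on; rewrite !inE xs.
by have [//|_ e] := uniq_min_size uqs sub; [rewrite size_map|exact: uniq_perm].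
Qed.

End BoundarySigns.

Section Incidence.
Variables (V : finType) (K : simplicial_complex V) (o : orientation K).
Implicit Types (F G : {set V}) (x : V).

Lemma ordering_uniq F : F \in faces K -> uniq (o F).
Proof. by move=> /(orderingP o) oF; rewrite (perm_uniq oF) enum_uniq. Qed.

Lemma mem_ordering F x : F \in faces K -> (x \in o F) = (x \in F).
Proof. by move=> /(orderingP o) oF; rewrite (perm_mem oF) mem_enum. Qed.

Lemma perm_rem_ordering F G x : F \in faces K -> G \in faces K ->
  perm_eq (rem x (o F)) (o G) = (G == F :\ x)%SET.
Proof.
move=> FK GK; apply/idP/eqP => [FG|GE].
  apply/setP => y; rewrite -(mem_ordering y GK) -(perm_mem FG).
  by rewrite mem_rem_uniq ?ordering_uniq // !inE mem_ordering.
apply: uniq_perm; rewrite ?rem_uniq ?ordering_uniq // => y.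
by rewrite mem_ordering // GE mem_rem_uniq ?ordering_uniq // !inE mem_ordering.
Qed.

Lemma bd_sign_eq0 F G : F \in faces K -> G \in faces K -> ~~ (G \subset F) ->
  bd_sign o G F = 0.
Proof.
move=> FK GK GF; rewrite /bd_sign big1 // => x _.
rewrite orient_sign_eq0 ?mulr0 ?rem_uniq ?ordering_uniq // perm_rem_ordering //.
by apply: contraNneq GF => ->; exact: finset.subD1set.
Qed.

(** Only the deletion of the vertex opposite to the facet contributes. *)
Lemma bd_sign_facet F x : F \in faces K -> (F :\ x)%SET \in faces K -> x \in F ->
  exists b : bool, bd_sign o (F :\ x)%SET F = (-1) ^+ b.
Proof.
move=> FK FxK xF; rewrite /bd_sign (bigD1_seq x) ?mem_ordering ?ordering_uniq //=.
rewrite [X in _ + X]big_seq_cond big1 => [|y /andP[yF yx]]; last first.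
  rewrite orient_sign_eq0 ?mulr0 ?rem_uniq ?ordering_uniq // perm_rem_ordering //.
  apply: contra yx => /eqP/setP/(_ x); rewrite !inE eqxx xF !andbT /= => /esym/negbFE.
  by rewrite eq_sym.
have [b ->] : exists b : bool, orient_sign (rem x (o F)) (o (F :\ x)%SET) = (-1) ^+ b.
  apply: orient_sign_neq0; first by rewrite rem_uniq ?ordering_uniq.
  by rewrite perm_rem_ordering.
by exists (odd (index x (o F)) (+) b); rewrite addr0 signr_addb signr_odd.
Qed.

Variable d : nat.
Implicit Types (t : simplex K d) (s : simplex K d.+1).

Definition facets s : {set simplex K d} :=
  [set t : simplex K d | val t \subset val s]%SET.

Lemma simplex_face e (u : simplex K e) : val u \in faces K.
Proof. by have /andP[] := valP u. Qed.

Lemma card_simplex e (u : simplex K e) : #|val u| = e.+1.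
Proof. by have /andP[_ /eqP] := valP u. Qed.

Lemma facetP t s : reflect (exists2 x, x \in val s & val t = (val s :\ x)%SET)
  (t \in facets s).
Proof.
rewrite inE; apply: (iffP idP) => [ts|[x _ ->]]; last exact: finset.subD1set.
have /cards1P[x sDt] : #|(val s :\: val t)%SET| == 1%N.
  by rewrite cardsD (finset.setIidPr ts) !card_simplex subSnn.
have : x \in (val s :\: val t)%SET by rewrite sDt finset.set11.
rewrite inE => /andP[_ xs]; exists x => //.
by rewrite -sDt finset.setDDr finset.setDv finset.set0U (finset.setIidPr ts).
Qed.

Lemma bd_sign_simplex t s :
  if t \in facets s then exists b : bool, bd_sign o (val t) (val s) = (-1) ^+ b
  else bd_sign o (val t) (val s) = 0.
Proof.
case: ifPn => [/facetP[x xs e]|]; last first.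
  by rewrite inE => ts; apply: bd_sign_eq0 => //; exact: simplex_face.
rewrite e; apply: bd_sign_facet => //; first exact: simplex_face.
by rewrite -e; exact: simplex_face.
Qed.

Lemma card_facets s : #|facets s| = d.+2.
Proof.
rewrite -(card_simplex s) -(card_imset _ val_inj).
have D1_inj : {in val s &, injective (fun x => val s :\ x)%SET}.
  move=> x y xs ys /setP/(_ x); rewrite !inE eqxx xs !andbT /= => /esym/negbFE.
  by move/eqP.
rewrite -(card_in_imset D1_inj); congr #|pred_of_set _|; apply/setP => F.
apply/imsetP/imsetP => [[t /facetP[x xs e] ->]|[x xs ->]]; first by exists x.
have cardF : #|(val s :\ x)%SET| = d.+1.
  by move: (cardsD1 x (val s)); rewrite xs card_simplex => -[].
have FK : (val s :\ x)%SET \in faces K.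
  apply: (faces_down (simplex_face s)); first exact: finset.subD1set.
  by rewrite -card_gt0 cardF.
pose P (G : {set V}) := (G \in faces K) && (#|G| == d.+1).
have FP : P (val s :\ x)%SET by rewrite /P FK cardF eqxx.
by exists (exist P _ FP : simplex K d); first by apply/facetP; exists x.
Qed.

End Incidence.

(** * Energy, weight and extremal eigenvectors *)

Section UpLaplacian.
Variables (R : realType) (V : finType) (K : simplicial_complex V) (o : orientation K).
Variables (d : nat) (p : R).
Local Notation chain := 'cV[R]_#|simplex K d|.
Implicit Types (t u : simplex K d) (s : simplex K d.+1) (x y : chain).
Local Notation F := (@up_energy R V K o d p).
Local Notation G := (@up_weight R V K d p).

Definition coeff x t : R := x (enum_rank t) 0.

Definition incidence t s : R := (bd_sign o (val t) (val s))%:~R.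

Definition coboundary_at x s : R := \sum_(t in facets s) incidence t s * coeff x t.

Lemma sum_enum_rank (T : finType) (f : 'I_#|T| -> R) :
  \sum_i f i = \sum_(t : T) f (enum_rank t).
Proof. exact: (reindex _ (onW_bij _ (@enum_rank_bij T))). Qed.

Lemma incidence_sqr t s : t \in facets s -> incidence t s * incidence t s = 1.
Proof.
move=> ts; have := bd_sign_simplex o t s; rewrite ts /incidence => -[b ->].
by rewrite rmorphXn /= mulrN1z -signr_addb addbb.
Qed.

Lemma norm_incidence t s : t \in facets s -> `|incidence t s| = 1.
Proof.
move=> ts; have := bd_sign_simplex o t s; rewrite ts /incidence => -[b ->].
by rewrite rmorphXn /= mulrN1z normr_sign.
Qed.

Lemma coboundary_atE x s :
  ((incidence_mx R o d)^T *m x) (enum_rank s) 0 = coboundary_at x s.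
Proof.
rewrite mxE sum_enum_rank /coboundary_at [RHS]big_mkcond; apply: eq_bigr => t _.
rewrite !mxE !enum_rankK -/(incidence t s); have := bd_sign_simplex o t s.
by rewrite /incidence; case: ifP => // _ ->; rewrite mul0r.
Qed.

Lemma up_energyE x : F x = \sum_s `|coboundary_at x s| `^ p.
Proof. by rewrite /up_energy sum_enum_rank; apply: eq_bigr => s _; rewrite coboundary_atE. Qed.

Lemma up_degree_sum t (c : R) : (up_degree t)%:R * c = \sum_(s | t \in facets s) c.
Proof.
rewrite (eq_bigl (mem [set s : simplex K d.+1 | val t \subset val s]%SET)).
  by rewrite sumr_const mulr_natl.
by move=> s; rewrite !inE.
Qed.

Lemma sum_up_degree (c : simplex K d -> R) :
  \sum_t (up_degree t)%:R * c t = \sum_s \sum_(t in facets s) c t.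
Proof.
rewrite (eq_bigr _ (fun t _ => up_degree_sum t (c t))).
by rewrite (exchange_big_dep predT).
Qed.

Lemma up_weightE x : G x = \sum_s \sum_(t in facets s) `|coeff x t| `^ p.
Proof.
rewrite /up_weight sum_enum_rank -sum_up_degree; apply: eq_bigr => t _.
by rewrite enum_rankK.
Qed.

Lemma coboundary_atZ (c : R) x s : coboundary_at (c *: x) s = c * coboundary_at x s.
Proof. by rewrite mulr_sumr; apply: eq_bigr => t _; rewrite /coeff mxE mulrCA. Qed.

Lemma up_energy_homogeneous : homogeneous p F.
Proof.
move=> c x c0; rewrite !up_energyE mulr_sumr; apply: eq_bigr => s _.
by rewrite coboundary_atZ normrM gtr0_norm // powRM // ltW.
Qed.

Lemma up_weight_homogeneous : homogeneous p G.
Proof.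
move=> c x c0; rewrite /up_weight mulr_sumr; apply: eq_bigr => i _.
by rewrite mxE normrM gtr0_norm // powRM ?normr_ge0 ?ltW // mulrCA.
Qed.

Lemma up_energy_ge0 x : 0 <= F x.
Proof. by rewrite up_energyE sumr_ge0 // => s _; exact: powR_ge0. Qed.

Lemma coeff_neq0 x : x != 0 -> exists t, coeff x t != 0.
Proof.
move=> x0; apply/existsP; apply: contraNT x0; rewrite negb_exists => /forallP x0.
apply/eqP/colP => i; rewrite mxE; apply/eqP.
by have := x0 (enum_val i); rewrite negbK /coeff enum_valK.
Qed.

Lemma up_weight_gt0 x : (forall t, exists s, t \in facets s) -> x != 0 -> 0 < G x.
Proof.
move=> hK /coeff_neq0[t xt]; have [s ts] := hK t; rewrite up_weightE.
rewrite (bigD1 s) //= (bigD1 t) //= -addrA ltr_wpDr ?powR_gt0 ?normr_gt0 //.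
apply: addr_ge0; apply: sumr_ge0 => u _; first exact: powR_ge0.
by apply: sumr_ge0 => v _; exact: powR_ge0.
Qed.

Local Notation lmax := (d.+2%:R `^ (p - 1)).

Lemma norm_incidenceM x t s : t \in facets s ->
  `|incidence t s * coeff x t| = `|coeff x t|.
Proof. by move=> ts; rewrite normrM norm_incidence // mul1r. Qed.

Lemma coboundary_at_le x s : 1 <= p ->
  `|coboundary_at x s| `^ p <= lmax * \sum_(t in facets s) `|coeff x t| `^ p.
Proof.
move=> p1; have := power_mean_le (A := facets s) (fun t => incidence t s * coeff x t) p1.
rewrite card_facets => /(_ isT) /le_trans; apply; rewrite le_eqVlt; apply/orP; left.
by apply/eqP; congr (_ * _); apply: eq_bigr => t ts; rewrite norm_incidenceM.
Qed.

Lemma up_energy_le x : 1 <= p -> F x <= lmax * G x.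
Proof.
move=> p1; rewrite up_energyE up_weightE mulr_sumr; apply: ler_sum => s _.
exact: coboundary_at_le.
Qed.

(** The equality case of the power mean inequality on every [(d+1)]-simplex. *)
Definition coherent x := forall s t u, t \in facets s -> u \in facets s ->
  incidence t s * coeff x t = incidence u s * coeff x u.

Lemma coherent_of_extremal x : 1 < p -> F x = lmax * G x -> coherent x.
Proof.
move=> p1; rewrite up_energyE up_weightE mulr_sumr => e s t u.
have : \sum_s (lmax * (\sum_(t in facets s) `|coeff x t| `^ p) -
    `|coboundary_at x s| `^ p) == 0 by rewrite sumrB -e subrr.
rewrite psumr_eq0 => [|s' _]; last by rewrite subr_ge0 coboundary_at_le // ltW.
move=> /allP/(_ s (mem_index_enum _)) /=; rewrite subr_eq0 => /eqP es.
apply: (power_mean_eq (x := fun t => incidence t s * coeff x t) p1).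
rewrite card_facets -es; congr (_ * _); apply: eq_bigr => v vs.
by rewrite norm_incidenceM.
Qed.

Lemma coherent_coboundary x s t : coherent x -> t \in facets s ->
  coboundary_at x s = d.+2%:R * (incidence t s * coeff x t).
Proof.
move=> cx ts; rewrite /coboundary_at (eq_bigr (fun=> incidence t s * coeff x t)).
  by rewrite sumr_const card_facets mulr_natl.
by move=> u us; exact: cx.
Qed.

Definition energy_gradient x : chain := \col_i
  \sum_(s | enum_val i \in facets s) incidence (enum_val i) s * slope p (coboundary_at x s).

Definition weight_gradient x : chain := \col_i
  ((up_degree (enum_val i))%:R * slope p (x i 0)).

(** Add up the tangent inequalities for the power function at the values of the
    coboundary, which is linear in the chain. *)
Lemma energy_subgradient x : 1 <= p -> subdifferential F x (energy_gradient x).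
Proof.
move=> p1 y; rewrite sum_enum_rank.
have -> : \sum_t energy_gradient x (enum_rank t) 0 * (y (enum_rank t) 0 - x (enum_rank t) 0) =
    \sum_s slope p (coboundary_at x s) * (coboundary_at y s - coboundary_at x s).
  have E t : energy_gradient x (enum_rank t) 0 * (y (enum_rank t) 0 - x (enum_rank t) 0) =
      \sum_(s | t \in facets s)
        slope p (coboundary_at x s) * (incidence t s * (coeff y t - coeff x t)).
    rewrite mxE enum_rankK mulr_suml; apply: eq_bigr => s _.
    by rewrite mulrAC mulrC.
  rewrite (eq_bigr _ (fun t _ => E t)) (exchange_big_dep predT) //=.
  apply: eq_bigr => s _; rewrite -mulr_sumr -sumrB; congr (_ * _).
  by apply: eq_bigr => t _; rewrite mulrBr.
rewrite !up_energyE -big_split /=; apply: ler_sum => s _; rewrite -subr_ge0.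
exact: tangent_gap_ge0.
Qed.

Lemma weight_subgradient x : 1 <= p -> subdifferential G x (weight_gradient x).
Proof.
move=> p1 y; rewrite /up_weight -big_split /=; apply: ler_sum => i _.
rewrite mxE -mulrA -mulrDr ler_wpM2l // -subr_ge0; exact: tangent_gap_ge0.
Qed.

Lemma slopeM (c a : R) : 0 < c -> slope p (c * a) = c `^ (p - 1) * slope p a.
Proof.
move=> c0; rewrite /slope sgrM gtr0_sg // mul1r normrM gtr0_norm // powRM ?normr_ge0 ?ltW //.
by ring.
Qed.

Lemma incidence_slope t s (a : R) : t \in facets s ->
  incidence t s * slope p (incidence t s * a) = slope p a.
Proof.
move=> ts; have := bd_sign_simplex o t s; rewrite ts /incidence => -[[] ->] /=.
  by rewrite expr1 !mulN1r slopeN opprK.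
by rewrite expr0 !mul1r.
Qed.

Lemma coherent_gradient x : coherent x ->
  energy_gradient x = lmax *: weight_gradient x.
Proof.
move=> cx; apply/colP => i; rewrite !mxE mulrCA up_degree_sum.
apply: eq_bigr => s ts; rewrite (coherent_coboundary cx ts) slopeM ?ltr0n //.
by rewrite mulrCA incidence_slope // /coeff enum_valK.
Qed.

(** Extremal eigenvectors: Euler's identity makes the power mean inequality an
    equality on every simplex; conversely the gradients of the two functions are
    explicit. *)
Lemma eigenvectors_maxE x : 1 < p ->
  eigenvectors F G lmax x <-> x != 0 /\ coherent x.
Proof.
move=> p1; have p1' := ltW p1; split=> [ex|[x0 cx]]; split => //.
- by case: ex.
- apply: coherent_of_extremal => //.
  exact: (eigenvector_quotient p1' up_energy_homogeneous up_weight_homogeneous).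
- exists (energy_gradient x); split; first exact: energy_subgradient.
  exists (weight_gradient x); first exact: weight_subgradient.
  by rewrite coherent_gradient.
Qed.

Lemma spectrum_bounds lam : (forall t, exists s, t \in facets s) -> 1 <= p ->
  spectrum F G lam -> 0 <= lam <= lmax.
Proof.
move=> hK p1 [x ex]; have x0 : x != 0 by case: ex.
have G0 := up_weight_gt0 hK x0.
have e := eigenvector_quotient p1 up_energy_homogeneous up_weight_homogeneous ex.
apply/andP; split; first by rewrite -(pmulr_lge0 _ G0) -e up_energy_ge0.
by rewrite -(ler_pM2r G0) -e up_energy_le.
Qed.

End UpLaplacian.

(** * Balance and switching in signed graphs *)

Section SignedGraph.
Variables (T : finType) (e : rel T) (sg : T -> T -> int).
Hypothesis e_irr : irreflexive e.
Hypothesis sgC : forall t u, e t u -> sg t u = sg u t.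
Hypothesis sg_sqr : forall t u, e t u -> sg t u * sg t u = 1.
Implicit Types (t u v : T) (c q w : seq T).

Fixpoint walk_sign t w : int :=
  if w is u :: w' then sg t u * walk_sign u w' else 1.

Lemma walk_sign_cat t w w' : walk_sign t (w ++ w') = walk_sign t w * walk_sign (last t w) w'.
Proof. by elim: w t => [|u w IH] t /=; rewrite ?mul1r // IH mulrA. Qed.

Lemma walk_sign_sqr t w : path e t w -> walk_sign t w * walk_sign t w = 1.
Proof.
elim: w t => [|u w IH] t //= /andP[tu uw].
by rewrite mulrACA sg_sqr // IH.
Qed.

Lemma prod_next_at v t w : uniq (t :: w) ->
  \prod_(u <- t :: w) sg u (next_at u v t w) = walk_sign t (rcons w v).
Proof.
elim: w t => [|u w IH] t; first by rewrite big_seq1 /= eqxx mulr1.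
rewrite cons_uniq => /andP[tuw uuw]; rewrite big_cons -/(rcons _ _) /= eqxx.
congr (_ * _); rewrite -[walk_sign u _]IH // !big_seq; apply: eq_bigr => t' t'uw /=.
by case: eqVneq t'uw tuw => [->->|].
Qed.

Lemma prod_cycle_sign t w : uniq (t :: w) ->
  \prod_(u <- t :: w) sg u (next (t :: w) u) = walk_sign t (rcons w t).
Proof. exact: prod_next_at. Qed.

Lemma not_uniq_split w : ~~ uniq w ->
  exists u w1 w2 w3, w = w1 ++ u :: w2 ++ u :: w3.
Proof.
elim: w => [//|u w IH]; rewrite /= negb_and negbK => /orP[uw|/IH].
  by case/splitPr: uw => w2 w3; exists u, [::], w2, w3.
by move=> [v [w1 [w2 [w3 ->]]]]; exists v, (u :: w1), w2, w3.
Qed.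

Section BalancedSet.
Variable C : {pred T}.
Hypothesis balancedC : forall c, (2 < size c)%N -> ucycle e c -> {subset c <= C} ->
  0 < \prod_(t <- c) sg t (next c t).

(** A closed walk is a simple cycle, or runs along an edge and back, or splits at
    a repeated vertex into two shorter closed walks. *)
Lemma closed_walk_sign t w : path e t w -> last t w = t -> {subset t :: w <= C} ->
  walk_sign t w = 1.
Proof.
have [n] := ubnP (size w); elim: n t w => // n IH t w.
case/lastP: w => [//|w u]; rewrite last_rcons size_rcons ltnS => wn tw ut.
subst u => wC.
have [utw|/not_uniq_split[u [w1 [w2 [w3 tw_eq]]]]] := boolP (uniq (t :: w)).
  case: w {IH wn} tw wC utw => [|u [|v w]] tw wC utw.
  - by move: tw; rewrite /= e_irr.
  - move: tw => /= /and3P[tu ut _]; rewrite mulr1.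
    by rewrite (sgC ut) sg_sqr.
  - have sub : {subset [:: t, u, v & w] <= C}.
      by move=> x xs; apply: wC; rewrite -rcons_cons mem_rcons in_cons xs orbT.
    have cyc : ucycle e [:: t, u, v & w] by rewrite /ucycle [path.cycle _ _]tw utw.
    have := balancedC (c := [:: t, u, v & w]) isT cyc sub; rewrite prod_cycle_sign //.
    have := walk_sign_sqr tw; move: (walk_sign _ _) => a /eqP.
    by rewrite -expr2 sqrf_eq1 => /orP[/eqP->|/eqP->].
have split_rcons v x1 x2 : rcons (x1 ++ v :: x2) t = rcons x1 v ++ rcons x2 t.
  by rewrite -cats1 -catA /= -cat_rcons cats1.
case: w1 tw_eq => [[ut w_eq]|t' w1 [_ w_eq]].
  subst u; rewrite w_eq split_rcons in tw wC *; move: tw; rewrite w_eq size_cat /= in wn.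
  rewrite cat_path last_rcons walk_sign_cat last_rcons => /andP[tw2 tw3].
  have part x : (x \in t :: rcons w2 t) || (x \in t :: rcons w3 t) -> x \in C.
    move=> xs; apply: wC; move: xs; rewrite !in_cons mem_cat.
    by case: (x == t).
  rewrite !IH ?mulr1 ?last_rcons ?size_rcons //; try lia.
    by move=> x x3; apply: part; rewrite x3 orbT.
  by move=> x x2; apply: part; rewrite x2.
rewrite w_eq !split_rcons in tw wC *.
rewrite w_eq !(size_cat, size_rcons) /= size_cat /= in wn.
move: tw; rewrite !cat_path !last_rcons !walk_sign_cat !last_rcons => /and3P[tw1 uw2 uw3].
rewrite [walk_sign u (rcons w2 u)]IH ?last_rcons ?size_rcons //; last 2 first.
- lia.
- move=> x xs; apply: wC; move: xs; rewrite !in_cons !mem_cat !mem_rcons !in_cons.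
  by case/orP => [->|]; rewrite ?orbT // => /orP[->|->]; rewrite ?orbT.
have := IH t (rcons w1 u ++ rcons w3 t).
rewrite walk_sign_cat cat_path last_cat !last_rcons tw1 uw3 mul1r; apply => //.
  by rewrite size_cat !size_rcons; lia.
move=> x xs; apply: wC; move: xs; rewrite !in_cons !mem_cat.
by case/orP => [->|/orP[]->]; rewrite ?orbT.
Qed.

Hypothesis C_closed : forall t u, e t u -> t \in C -> u \in C.

Lemma walk_in_closed t w : t \in C -> path e t w -> {subset t :: w <= C}.
Proof.
elim: w t => [|u w IH] t tC; first by move=> _ x; rewrite inE => /eqP ->.
move=> /= /andP[tu uw] x; rewrite in_cons => /predU1P[->//|].
exact: IH (C_closed tu tC) uw x.
Qed.

(** The sign of a walk from a root [r] depends only on its end, because each such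
    walk closes up with every walk back to [r]; it is a switching function. *)
Lemma switching_function r : connect_sym e -> r \in C ->
  exists theta : T -> int, forall t, connect e r t ->
    theta t * theta t = 1 /\ forall u, e t u -> theta u = theta t * sg t u.
Proof.
move=> ecs rC.
have walk_to t : exists w, connect e r t -> path e r w /\ last r w = t.
  case: (boolP (connect e r t)) => [/connectP[w rw ->]|_]; last by exists [::].
  by exists w.
have walk_from t : exists w, connect e r t -> path e t w /\ last t w = r.
  case: (boolP (connect e r t)) => [|_]; last by exists [::].
  by rewrite ecs => /connectP[w tw ->]; exists w.
have [to toP] := fin_all_exists walk_to.
have [from fromP] := fin_all_exists walk_from.
have closed t u w : connect e r t -> connect e r u -> path e t w -> last t w = u ->
    walk_sign r (to t) * (walk_sign t w * walk_sign u (from u)) = 1.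
  move=> rt ru tw wu; have [pt lt] := toP _ rt; have [pu lu] := fromP _ ru.
  have rw : path e r (to t ++ w ++ from u) by rewrite !cat_path pt lt tw wu pu.
  rewrite -{1}wu -walk_sign_cat -{2}lt -walk_sign_cat; apply: closed_walk_sign => //.
    by rewrite !last_cat lt wu.
  exact: walk_in_closed.
have sign_unit t w (b : int) : path e t w -> walk_sign t w * b = 1 -> b = walk_sign t w.
  by move=> tw h; rewrite -[b]mul1r -(walk_sign_sqr tw) -mulrA h mulr1.
exists (fun t => walk_sign r (to t)) => t rt; have [pt lt] := toP _ rt.
split; first exact: walk_sign_sqr.
move=> u tu; have ru : connect e r u by apply: connect_trans rt (connect1 tu).
have [pu lu] := toP _ ru.
have cu : walk_sign u (from u) = walk_sign r (to u).
  by apply: sign_unit => //; have := closed u u [::] ru ru isT erefl; rewrite mul1r.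
have := closed t u [:: u] rt ru; rewrite /= tu mulr1 cu mulrA => /(_ isT erefl).
by move=> h; rewrite -[RHS]mulr1 -(walk_sign_sqr pu) mulrA h mul1r.
Qed.

End BalancedSet.

(** Multiply the relations of the edges of the cycle: both sides contain the product
    of all the values of [x], which cancels. *)
Lemma balanced_of_switching (R : numDomainType) (x : T -> R) c :
  (forall t u, e t u -> x t = (sg t u)%:~R * x u) ->
  ucycle e c -> (forall t, t \in c -> x t != 0) ->
  \prod_(t <- c) sg t (next c t) = 1.
Proof.
move=> xe /andP[ec uc] xc; set P := \prod_(t <- c) _.
have prod_x : \prod_(t <- c) x t = P%:~R * \prod_(t <- c) x (next c t).
  rewrite rmorph_prod -big_split /= !big_seq; apply: eq_bigr => t tc.
  by apply: xe; exact: next_cycle.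
have prod_next : \prod_(t <- c) x (next c t) = \prod_(t <- c) x t.
  rewrite -(big_map (next c) predT x); apply: perm_big.
  apply: uniq_perm => //; first by rewrite map_inj_uniq //; exact: can_inj (prev_next uc).
  move=> t; apply/mapP/idP => [[u uc' ->]|tc]; first by rewrite mem_next.
  by exists (prev c t); rewrite ?mem_prev // next_prev.
have x0 : \prod_(t <- c) x t != 0 by rewrite prodf_seq_neq0; apply/allP => t /xc.
apply/eqP; rewrite -(eqr_int R); apply/eqP/(mulIf x0).
by rewrite mul1r -{1}prod_next -prod_x.
Qed.

End SignedGraph.

(** * Coherent chains and their genus *)

Lemma cvg_mx (R : realType) (T : Type) (F : set_system T) m n (f : T -> 'M[R]_(m, n))
    (l : 'M[R]_(m, n)) {FF : Filter F} :
  (forall i j, f z i j @[z --> F] --> l i j) -> f z @[z --> F] --> l.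
Proof.
move=> fl; apply/cvg_ballP => eps eps0.
have : \forall z \near F, forall ij : 'I_m * 'I_n, ball (l ij.1 ij.2) eps (f z ij.1 ij.2).
  by apply: filter_forall => -[i j]; have /cvg_ballP/(_ _ eps0) := fl i j.
by apply: filterS => z zl; split=> // i j; exact: (zl (i, j)).
Qed.

Section ExtremalEigenvectors.
Variables (R : realType) (V : finType) (K : simplicial_complex V) (o : orientation K).
Variable d : nat.
Local Notation chain := 'cV[R]_#|simplex K d|.
Local Notation adj := (@up_adj V K d).
Implicit Types (t u : simplex K d) (s : simplex K d.+1) (x : chain).

Lemma up_adj_irreflexive : irreflexive adj.
Proof. by move=> t; rewrite /up_adj eqxx. Qed.

Lemma up_adj_sym : symmetric adj.
Proof.
move=> t u; rewrite /up_adj eq_sym; congr (_ && _); apply: eq_existsb => s.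
by rewrite andbC.
Qed.

Lemma up_adjP t u : reflect (t != u /\ exists s, t \in facets s /\ u \in facets s) (adj t u).
Proof.
apply: (iffP andP) => [[tu /existsP[s /andP[ts us]]]|[tu [s []]]].
  by split=> //; exists s; rewrite !inE.
by rewrite !inE => ts us; split=> //; apply/existsP; exists s; rewrite ts us.
Qed.

Lemma edge_sign_incidence t u s : t != u -> t \in facets s -> u \in facets s ->
  (edge_sign o t u)%:~R = incidence R o t s * incidence R o u s.
Proof. by rewrite !inE => tu ts us; rewrite (edge_signE o tu ts us) rmorphM. Qed.

Lemma edge_signC t u : adj t u -> edge_sign o t u = edge_sign o u t.
Proof.
case/up_adjP => tu [s [ts us]]; apply/eqP; rewrite -(eqr_int R).
by rewrite !(edge_sign_incidence (s := s)) // 1?eq_sym // mulrC.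
Qed.

Lemma edge_sign_sqr t u : adj t u -> edge_sign o t u * edge_sign o t u = 1.
Proof.
case/up_adjP => tu [s [ts us]]; apply/eqP; rewrite -(eqr_int R) rmorphM /=.
by rewrite !(edge_sign_incidence (s := s)) // mulrACA !incidence_sqr // mulr1.
Qed.

Lemma coherentP x : coherent o x <->
  forall t u, adj t u -> coeff x t = (edge_sign o t u)%:~R * coeff x u.
Proof.
split=> [cx t u /up_adjP[tu [s [ts us]]]|ex s t u ts us].
  rewrite (edge_sign_incidence tu ts us) -mulrA -(cx s t u ts us) mulrA.
  by rewrite incidence_sqr // mul1r.
have [->//|tu] := eqVneq t u.
have /ex -> : adj t u by apply/up_adjP; split=> //; exists s.
by rewrite (edge_sign_incidence tu ts us) !mulrA incidence_sqr // mul1r.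
Qed.

Lemma up_componentsP (C : {set simplex K d}) :
  C \in up_components K d <-> exists r, C = [set t | connect adj r t]%SET.
Proof.
split=> [/imsetP[r _ ->]|[r ->]].
  by exists r; apply/setP => t; rewrite !inE.
by apply/imsetP; exists r; rewrite ?inE //; apply/setP => t; rewrite !inE.
Qed.

Lemma connect_adj_sym : connect_sym adj.
Proof. exact: sym_connect_sym up_adj_sym. Qed.

Lemma coherent_connect_neq0 x t u : coherent o x -> connect adj t u ->
  (coeff x t != 0) = (coeff x u != 0).
Proof.
move=> /coherentP cx; apply: (@closed_connect _ adj [pred v | coeff x v != 0]) => v w vw.
rewrite !inE (cx _ _ vw) mulf_eq0 negb_or intr_eq0 andb_idl // => _.
by apply/eqP => s0; have := edge_sign_sqr vw; rewrite s0 mul0r.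
Qed.

Lemma component_balanced x t : coherent o x -> coeff x t != 0 ->
  [set u | connect adj t u]%SET \in balanced_components o d.
Proof.
move=> cx xt; rewrite inE; apply/andP; split.
  by apply/up_componentsP; exists t.
apply/asboolP => c _ ec cC.
rewrite (balanced_of_switching (R := R) (e := adj) (x := coeff x)) // => [|u /cC].
  exact/coherentP.
by rewrite inE => /(coherent_connect_neq0 cx) <-.
Qed.

Lemma balanced_switching : exists (root : 'I_#|balanced_components o d| -> simplex K d)
    (theta : 'I_#|balanced_components o d| -> simplex K d -> int),
  forall i, enum_val i = [set t | connect adj (root i) t]%SET /\
    forall t, connect adj (root i) t -> theta i t * theta i t = 1 /\
      forall u, adj t u -> theta i u = theta i t * edge_sign o t u.
Proof.
have component (i : 'I_#|balanced_components o d|) :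
    exists r, enum_val i = [set t | connect adj r t]%SET.
  by apply/up_componentsP; have := enum_valP i; rewrite inE => /andP[].
have [root rootP] := fin_all_exists component; exists root.
have switching i : exists theta : simplex K d -> int, forall t, connect adj (root i) t ->
    theta t * theta t = 1 /\ forall u, adj t u -> theta u = theta t * edge_sign o t u.
  have := enum_valP i; rewrite inE => /andP[_ /asboolP bal].
  apply: (switching_function up_adj_irreflexive edge_signC edge_sign_sqr bal).
  - by move=> t u tu; rewrite rootP !inE => rt; exact: connect_trans rt (connect1 tu).
  - exact: connect_adj_sym.
  - by rewrite rootP inE connect0.
have [theta thetaP] := fin_all_exists switching.
by exists theta => i; split; [exact: rootP|exact: thetaP].
Qed.

Section Coordinates.
Local Notation k := #|balanced_components o d|.
Variables (root : 'I_k -> simplex K d) (theta : 'I_k -> simplex K d -> int).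
Hypothesis rootE : forall i, enum_val i = [set t | connect adj (root i) t]%SET.
Hypothesis theta_sqr : forall i t, connect adj (root i) t -> theta i t * theta i t = 1.
Hypothesis theta_edge : forall i t u, connect adj (root i) t -> adj t u ->
  theta i u = theta i t * edge_sign o t u.

Definition switching_coeff t i : R :=
  if connect adj (root i) t then (theta i t)%:~R else 0.

Definition coherent_chain (y : 'rV[R]_k) : chain :=
  \col_a \sum_i switching_coeff (enum_val a) i * y 0 i.

Lemma coeff_coherent_chain y t :
  coeff (coherent_chain y) t = \sum_i switching_coeff t i * y 0 i.
Proof. by rewrite /coeff mxE enum_rankK. Qed.

Lemma coherent_chain_coherent y : coherent o (coherent_chain y).
Proof.
apply/coherentP => t u tu; rewrite !coeff_coherent_chain mulr_sumr.
apply: eq_bigr => i _; rewrite mulrA; congr (_ * _); rewrite /switching_coeff.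
have -> : connect adj (root i) u = connect adj (root i) t.
  by rewrite !(connect_adj_sym (root i)) (same_connect connect_adj_sym (connect1 tu)).
case: ifP => [rt|_]; last by rewrite mulr0.
by rewrite (theta_edge rt tu) -rmorphM /= mulrCA edge_sign_sqr // mulr1.
Qed.

Lemma root_connect i j : connect adj (root j) (root i) -> i = j.
Proof.
move=> rji; apply: enum_val_inj; rewrite !rootE; apply/setP => t; rewrite !inE.
by rewrite (same_connect connect_adj_sym rji).
Qed.

Lemma coeff_coherent_chain_root y i :
  coeff (coherent_chain y) (root i) = (theta i (root i))%:~R * y 0 i.
Proof.
rewrite coeff_coherent_chain (bigD1 i) //= big1 ?addr0 => [|j ji].
  by rewrite /switching_coeff connect0.
rewrite /switching_coeff; case: ifP => [/root_connect ij|_]; last by rewrite mul0r.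
by rewrite ij eqxx in ji.
Qed.

Lemma coherent_chain_neq0 y : y != 0 -> coherent_chain y != 0.
Proof.
apply: contra_neq => y0; apply/rowP => i; rewrite mxE; apply/eqP.
have := coeff_coherent_chain_root y i; rewrite y0 /coeff mxE => /esym/eqP.
rewrite mulf_eq0 intr_eq0 => /orP[/eqP th0|//].
by have := theta_sqr (connect0 adj (root i)); rewrite th0 mul0r.
Qed.

Lemma coherent_chainN y : coherent_chain (- y) = - coherent_chain y.
Proof.
apply/colP => a; rewrite !mxE -sumrN; apply: eq_bigr => i _.
by rewrite mxE mulrN.
Qed.

Lemma coherent_chain_continuous : continuous coherent_chain.
Proof.
move=> y; apply: (cvg_mx (F := nbhs y)) => a j; rewrite (ord1 j) mxE.
under eq_cvg do rewrite mxE.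
apply: (cvg_big (op := +%R) (@add_continuous _)) => i _.
by apply: cvgM; [exact: cvg_cst|exact: coord_continuous].
Qed.

Definition root_norm x : R := \sum_i coeff x (root i) ^+ 2.

Definition root_coordinates x : 'cV[R]_k :=
  \col_i (coeff x (root i) * (Num.sqrt (root_norm x))^-1).

(** A chain that is coherent and nonzero does not vanish at any vertex of some
    component; that component is balanced, so its root is one of the [root i]. *)
Lemma root_norm_gt0 x : x != 0 -> coherent o x -> 0 < root_norm x.
Proof.
move=> /coeff_neq0[t xt] cx.
have tB := component_balanced cx xt.
have [i Ci] : exists i : 'I_k, enum_val i = [set u | connect adj t u]%SET.
  by exists (enum_rank_in tB [set u | connect adj t u]%SET); rewrite enum_rankK_in.
have xi : coeff x (root i) != 0.
  have : root i \in enum_val i by rewrite rootE inE connect0.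
  by rewrite Ci inE => /(coherent_connect_neq0 cx) <-.
rewrite /root_norm (bigD1 i) //= ltr_wpDr ?sumr_ge0 // => [j _|]; first exact: sqr_ge0.
by rewrite lt_neqAle sqr_ge0 eq_sym sqrf_eq0 xi.
Qed.

Lemma root_normN x : root_norm (- x) = root_norm x.
Proof. by apply: eq_bigr => i _; rewrite /coeff mxE sqrrN. Qed.

Lemma root_coordinatesN x : root_coordinates (- x) = - root_coordinates x.
Proof. by apply/colP => i; rewrite !mxE root_normN /coeff mxE mulNr. Qed.

Lemma root_coordinates_sphere x : 0 < root_norm x -> unit_sphere (root_coordinates x).
Proof.
move=> N0; rewrite /unit_sphere /=.
rewrite (eq_bigr (fun i => coeff x (root i) ^+ 2 * (root_norm x)^-1)) => [|i _].
  by rewrite -mulr_suml mulfV // gt_eqF.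
by rewrite mxE exprMn exprVn sqr_sqrtr // ltW.
Qed.

Lemma coeff_continuous t : continuous (fun x : chain => coeff x t).
Proof. exact: coord_continuous. Qed.

Lemma root_norm_continuous : continuous root_norm.
Proof.
apply: (@continuous_big R _ +%R 0 predT (@add_continuous _)) => l _ x.
exact: (continuousM (@coeff_continuous (root l) x) (@coeff_continuous (root l) x)).
Qed.

Lemma root_coordinates_continuous x : 0 < root_norm x -> {for x, continuous root_coordinates}.
Proof.
move=> N0; apply: (cvg_mx (F := nbhs x)) => i j; rewrite mxE.
under eq_cvg do rewrite mxE.
apply: (cvgM (@coeff_continuous (root i) x)).
apply: cvgV; first by rewrite gt_eqF // sqrtr_gt0.
apply: (@continuous_comp _ _ _ root_norm); first exact: root_norm_continuous.
exact: sqrt_continuous.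
Qed.

Lemma octahedral_sphere_neq0 n (y : 'rV[R]_n) : octahedral_sphere y -> y != 0.
Proof.
rewrite /octahedral_sphere /= => y1; apply: contra_eq_neq y1 => ->.
by rewrite big1 ?(eq_sym 0) ?oner_neq0 // => i _; rewrite mxE normr0.
Qed.

(** The nonzero coherent chains form a punctured space of dimension [k]: the
    coordinates at the roots map them to the sphere, and the Borsuk-Ulam theorem
    applied to their parametrization rules out smaller spheres. *)
Lemma genus_coherent (A : set chain) : (forall x, A x <-> x != 0 /\ coherent o x) ->
  is_genus A k.
Proof.
move=> AE; split.
  exists root_coordinates; split => [|x /AE[x0 cx]|x _].
  - apply: continuous_in_subspaceT => x /set_mem/AE[x0 cx].
    by apply: root_coordinates_continuous; exact: root_norm_gt0.
  - by apply: root_coordinates_sphere; exact: root_norm_gt0.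
  - exact: root_coordinatesN.
move=> m [f [cf f1 fN]].
have chainA y : octahedral_sphere y -> A (coherent_chain y).
  move=> /octahedral_sphere_neq0 y0; apply/AE; split; first exact: coherent_chain_neq0.
  exact: coherent_chain_coherent.
apply: (borsuk_ulam (f := f \o coherent_chain)).
- apply/subspace_continuousP => y yS /=.
  move/subspace_continuousP: cf => /(_ _ (chainA _ yS)) cf.
  apply: cvg_comp cf => U AU.
  have : \forall z \near y, A (coherent_chain z) -> U (coherent_chain z).
    exact: (@coherent_chain_continuous y _ AU).
  exact: (@filterS _ (nbhs y) _ _ _ (fun z zU zS => zU (chainA z zS))).
- by move=> y /chainA /f1.
- by move=> y /chainA yA /=; rewrite coherent_chainN fN.
Qed.

End Coordinates.
End ExtremalEigenvectors.

Theorem proposition4p4 (R : realType) (V : finType) (K : simplicial_complex V)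
    (o : orientation K) (d : nat) (p : R)
    (hK : forall t : simplex K d, exists s : simplex K d.+1, val t \subset val s)
    (hp : 1 <= p) :
  let F := @up_energy R V K o d p in
  let G := @up_weight R V K d p in
  let lmax := (d.+2)%:R `^ (p - 1) in
  (forall lam : R, spectrum F G lam -> 0 <= lam <= lmax) /\
  (1 < p ->
     (spectrum F G lmax <->
        exists C : {set simplex K d}, C \in up_components K d /\ balanced o C) /\
     is_multiplicity F G lmax #|balanced_components o d|).
Proof.
move=> F G lmax; split=> [lam|p1].
  by apply: spectrum_bounds => // t; have [s ts] := hK t; exists s; rewrite inE.
have [root [theta rootP]] := balanced_switching R o d.
have rootE i := (rootP i).1.
have theta_sqr i t (rt : connect (@up_adj V K d) (root i) t) := ((rootP i).2 t rt).1.
have theta_edge i t u (rt : connect (@up_adj V K d) (root i) t) := ((rootP i).2 t rt).2 u.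
split; last first.
  by apply: (genus_coherent rootE theta_sqr theta_edge) => x; exact: eigenvectors_maxE.
split=> [[x /(eigenvectors_maxE _ _ p1)[/coeff_neq0[t xt] cx]]|[C [Ccomp Cbal]]].
  have := component_balanced cx xt; rewrite inE => /andP[Ccomp /asboolP Cbal].
  by exists [set u | connect (@up_adj V K d) t u]%SET.
have CB : C \in balanced_components o d.
  by rewrite inE Ccomp; apply/asboolP.
exists (coherent_chain root theta (delta_mx 0 (enum_rank_in CB C))).
apply/eigenvectors_maxE => //; split.
  apply: coherent_chain_neq0 => //; apply/eqP => /rowP/(_ (enum_rank_in CB C)).
  by rewrite !mxE !eqxx => /eqP; rewrite oner_eq0.
exact: coherent_chain_coherent.
Qed.
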